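(* Let $\omega,\gamma\in\mathbb{R}$ and let $u_0\in H^4(\mathbb{R})$. Let $u=u(t,x)$ be the solution, with lifespan $T>0$, of the Cauchy problem $$m_t+2\omega u_x+um_x+2u_xm=-\gamma u_{xxx}\quad (t>0,\ x\in\mathbb{R}),\qquad u(0,x)=u_0(x)\quad (x\in\mathbb{R}),$$ where $m:=u-u_{xx}$, and let $m_0:=u_0-u_0''$. If the function $x\mapsto m_0(x)+\omega+\gamma/2$ has compact support, then for every $t\in(0,T)$ the function $x\mapsto m(t,x)+\omega+\gamma/2$ has compact support.
   Context: The equation is the Dullin-Gottwald-Holm (DGH) equation (with parameter $\alpha=1$). For $u_0\in H^s(\mathbb{R})$, $s>3/2$, the Cauchy problem is known to have a unique solution $u\in C^0([0,T);H^s(\mathbb{R}))\cap C^1([0,T);H^{s-1}(\mathbb{R}))$ with a maximal existence time $T>0$, called its lifespan; ''the solution corresponding to $u_0$'' means this one. *)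

(* Defs.v *)
From HB Require Import structures.
From mathcomp Require Import all_boot all_order all_algebra.
From mathcomp Require Import all_classical all_reals all_analysis.

Set Implicit Arguments.
Unset Strict Implicit.
Unset Printing Implicit Defensive.

Import Order.TTheory GRing.Theory Num.Theory.
Import numFieldNormedType.Exports.

Local Open Scope classical_set_scope.
Local Open Scope ring_scope.

Definition compactly_supported (R : realType) (f : R -> R) : Prop :=
  compact (closure [set x | f x != 0]).

Definition test_function (R : realType) (phi : R -> R) : Prop :=
  (forall (n : nat) (x : R), derivable (derive1n n phi) x 1) /\
  compactly_supported phi.

Definition square_integrable (R : realType) (f : R -> R) : Prop :=
  f \in Lfun (@lebesgue_measure R) 2%:E.

Definition is_weak_derive (R : realType) (f g : R -> R) : Prop :=
  square_integrable g /\
  forall phi : R -> R, test_function phi ->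
    \int[@lebesgue_measure R]_x (f x * derive1 phi x) =
    - \int[@lebesgue_measure R]_x (g x * phi x).

(* Membership of the class of [f] in H^k(R), independently of the
   representative. *)
Fixpoint weak_sobolev (R : realType) (k : nat) (f : R -> R) : Prop :=
  square_integrable f /\
  if k is k'.+1 then exists g : R -> R, is_weak_derive f g /\ weak_sobolev k' g
  else True.

(* Elements of H^k(R), k >= 1, are identified with their continuous
   representative; by Sobolev embedding it is then of class C^(k-1), with
   classical derivatives equal to the weak ones. *)
Definition sobolev (R : realType) (k : nat) (f : R -> R) : Prop :=
  weak_sobolev k f /\ continuous f.

(* A weak derivative is unique only up to a null set, so this is one chosen
   representative; the norm below does not depend on the choice. *)
Definition weak_derive (R : realType) (f : R -> R) : R -> R :=
  xget (cst 0 : R -> R) [set g | is_weak_derive f g].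

Definition sobolev_norm (R : realType) (k : nat) (f : R -> R) : \bar R :=
  ((\sum_(j < k.+1)
      'N[@lebesgue_measure R]_2%:E[EFin \o iter j (@weak_derive R) f] ^+ 2)
   `^ (2^-1))%E.

Definition lifespan_interval (R : realType) (T : \bar R) : set R :=
  [set t | 0 <= t /\ (t%:E < T)%E].

(* u \in C^0([0,T); H^k(R)) *)
Definition C0_sobolev (R : realType) (T : \bar R) (k : nat)
    (u : R -> R -> R) : Prop :=
  (forall t, lifespan_interval T t -> sobolev k (u t)) /\
  (forall t, lifespan_interval T t ->
    sobolev_norm k (u s \- u t)
      @[s --> within (lifespan_interval T) (nbhs t)] --> 0%E).

(* u \in C^1([0,T); H^k(R)); the derivative at t = 0 is one-sided. *)
Definition C1_sobolev (R : realType) (T : \bar R) (k : nat)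
    (u : R -> R -> R) : Prop :=
  C0_sobolev T k u /\
  exists v : R -> R -> R,
    C0_sobolev T k v /\
    (forall t, lifespan_interval T t ->
      sobolev_norm k (fun x => (s - t)^-1 * (u s x - u t x) - v t x)
        @[s --> within (lifespan_interval T `\ t) (nbhs t)] --> 0%E).

Definition momentum (R : realType) (f : R -> R) : R -> R :=
  fun x => f x - derive1n 2 f x.

(* In the class required by [DGH_solution], u(t,.) is C^3, u_t(t,.) is C^2 and
   m is C^1 in t with values in H^1(R), so all the derivatives below exist in
   the classical sense, and the equation in H^1(R) is the pointwise one. *)
Definition DGH_equation (R : realType) (omega gamma : R) (T : \bar R)
    (u : R -> R -> R) : Prop :=
  let m t x := momentum (u t) x in
  forall t x : R, 0 < t -> (t%:E < T)%E ->
    derive1 (fun s => m s x) t + 2 * omega * derive1 (u t) x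
      + u t x * derive1 (m t) x + 2 * derive1 (u t) x * m t x
    = - gamma * derive1n 3 (u t) x.

Definition DGH_solution (R : realType) (omega gamma : R) (u0 : R -> R)
    (T : \bar R) (u : R -> R -> R) : Prop :=
  [/\ C0_sobolev T 4 u, C1_sobolev T 3 u,
      DGH_equation omega gamma T u & forall x, u 0 x = u0 x].

(* Values of u(t,.) for t outside [0,T) are irrelevant. *)
Definition DGH_solution_with_lifespan (R : realType) (omega gamma : R)
    (u0 : R -> R) (T : \bar R) (u : R -> R -> R) : Prop :=
  [/\ (0 < T)%E, DGH_solution omega gamma u0 T u &
      forall (T' : \bar R) (v : R -> R -> R),
        (0 < T')%E -> DGH_solution omega gamma u0 T' v -> (T' <= T)%E].

(* Main.v *)
(* By Sobolev embedding [m_0] tends to 0 at infinity, so that [m_0 + omega + gamma/2]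
   can only have compact support when [omega + gamma/2 = 0]. The equation then
   reads [m_t + (u - gamma) m_x + 2 u_x m = 0], a linear transport equation for
   [m] with bounded coefficients, and its solutions propagate at speed at most
   [K = sup |u - gamma|]. This is a maximum principle: if [m] vanishes initially to
   the right of [c], then [exp(- C t) m cutoff(x - c - K t)], where the cutoff
   vanishes on the negative reals and is increasing and bounded, cannot have a
   positive maximum for [C] large.

   A function and its weak derivative are related by the fundamental theorem of
   calculus at Lebesgue points, by testing against smooth trapezoids; the classical
   derivatives of elements of H^k and their sup norms are obtained from it. *)
Require Import Defs.
From HB Require Import structures.
From mathcomp Require Import all_boot all_order all_algebra.
From mathcomp Require Import all_classical all_reals all_analysis.
From mathcomp Require Import measurable_realfun ring lra.

Set Implicit Arguments.
Unset Strict Implicit.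
Unset Printing Implicit Defensive.

Import Order.TTheory GRing.Theory Num.Theory.
Import numFieldNormedType.Exports.

Local Open Scope classical_set_scope.
Local Open Scope ring_scope.

(** * Smooth functions and bumps *)

Section smooth.
Context {R : realType}.
Implicit Types (f g : R -> R) (p : {poly R}).

(** Following the characteristics would require constructing a flow; the maximum principle only uses
    derivatives at one point of space-time. Its difficulty is the existence of that point, the line
    not being compact. Decay at infinity gives a maximum in [x] at each time, and convergence in
    H^k, which is uniform convergence of the derivatives of lower order, makes the maximal value
    continuous in time. The equation is available only at positive times; time 0 is excluded because
    [m] vanishes there wherever the cutoff does not. The argument bounds [m] from above on the
    right; replacing [m] by [- m] and [x] by [- x] gives the other cases. The Sobolev norm is built
    by iterating a weak derivative picked by choice. It can be compared with classical derivatives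
    because weak derivatives are unique almost everywhere and the choice depends only on the class
    of the function. *)

Definition smooth f := forall n x, derivable ((derive1n n f)) x 1.

(** It suffices to find a class of differentiable functions stable under derivation. It serves for
    the family [flat_exp p], whose derivatives stay in the family. *)
Lemma smooth_coind (P : (R -> R) -> Prop) f :
  (forall g, P g -> (forall x, derivable g x 1) /\ P (derive1 g)) -> P f -> smooth f.
Proof.
move=> PD Pf n; have : P (derive1n n f) by elim: n => //= n /PD[].
by move=> /PD[].
Qed.

(** Derivatives are peeled off from the inside, so that closure under products follows by induction
    from the product rule, without the Leibniz formula. *)
Fixpoint derivable_upto n f : Prop :=
  (forall x, derivable f x 1) /\
  if n is n'.+1 then derivable_upto n' (derive1 f) else True.

Lemma derivable_uptoS n f : derivable_upto n.+1 f -> derivable_upto n f.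
Proof.
by elim: n f => [f [df _]|n IH f [df /IH df']]; split=> //; exact: df.
Qed.

Lemma smoothP f : smooth f <-> forall n, derivable_upto n f.
Proof.
split=> [sf n|df].
  elim: n f sf => [|n IH] f sf /=; split=> //; try exact: (sf 0%N).
  by apply: IH => m x; have := sf m.+1 x; rewrite derive1Sn.
move=> n; elim: n f df => [|n IH] f df x; first by have [] := df 0%N.
by rewrite derive1Sn; apply: IH => m; have [] := df m.+1.
Qed.

Lemma derivable_uptoD n f g :
  derivable_upto n f -> derivable_upto n g -> derivable_upto n (f + g).
Proof.
elim: n f g => [|n IH] f g.
  by move=> [df _] [dg _]; split; [move=> x; exact: derivableD|].
move=> [df f'] [dg g']; split=> [x|]; first exact: derivableD.
suff -> : derive1 (f + g) = (derive1 f) + (derive1 g) by exact: IH.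
by apply/funext => x; rewrite derive1E deriveD -?derive1E.
Qed.

Lemma derivable_uptoM n f g :
  derivable_upto n f -> derivable_upto n g -> derivable_upto n (f * g).
Proof.
elim: n f g => [|n IH] f g.
  by move=> [df _] [dg _]; split; [move=> x; exact: derivableM|].
move=> nf ng; have [[df f'] [dg g']] := (nf, ng).
split=> [x|]; first exact: derivableM.
suff -> : derive1 (f * g) = (f * derive1 g) + (g * derive1 f).
  by apply: derivable_uptoD; apply: IH => //; exact: derivable_uptoS.
by apply/funext => x; rewrite derive1E deriveM -?derive1E.
Qed.

Lemma smoothM f g : smooth f -> smooth g -> smooth (f * g).
Proof.
by move=> /smoothP sf /smoothP sg; apply/smoothP => n; exact: derivable_uptoM.
Qed.

Lemma is_derive_affine_comp f (c d x df : R) :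
  is_derive (c * x + d) 1 f df ->
  is_derive x 1 (fun y => f (c * y + d)) (c * df).
Proof.
move=> dfx.
have h : is_derive x 1 (fun y : R => c * y + d) c.
  have -> : (fun y : R => c * y + d) = (c \*: id) \+ cst d by [].
  by apply: is_derive_eq; rewrite addr0 [LHS]mulr1.
rewrite mulrC; exact: (@is_derive1_comp _ f (fun y : R => c * y + d) x _ _ dfx h).
Qed.

Lemma derivable_uptoZ n (c : R) f :
  derivable_upto n f -> derivable_upto n (fun x => c * f x).
Proof.
elim: n f => [|n IH] f.
  by move=> [df _]; split; [move=> x; exact: derivableM|].
move=> [df f']; split=> [x|]; first exact: derivableM.
suff -> : derive1 (fun x => c * f x) = (fun x => c * (derive1 f) x) by exact: IH.
by apply/funext => x; rewrite derive1Ml.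
Qed.

Lemma smooth_affine_comp f (c d : R) :
  smooth f -> smooth (fun x => f (c * x + d)).
Proof.
move=> /smoothP sf; apply/smoothP => n; elim: n f {sf}(sf n) => [|n IH] f /= [df f'].
- split=> // x; have := @is_derive_affine_comp f c d x _ (derivableP (df _)).
  by case.
- have D x := @is_derive_affine_comp f c d x _ (derivableP (df _)).
  split=> [x|]; first by case: (D x).
  suff -> : derive1 (fun x => f (c * x + d)) = (fun x => c * (derive1 f) (c * x + d)).
    by apply: derivable_uptoZ; exact: IH.
  by apply/funext => x; rewrite !derive1E derive_val.
Qed.

(** A single term of the exponential series gives [y ^ i <= i! * expR y]; the constant sums this
    over the coefficients. *)
Lemma horner_le_expR p : exists2 C : R, 0 <= C &
  forall y, 0 <= y -> `|p.[y]| <= C * expR y.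
Proof.
exists (\sum_(i < size p) `|p`_i| * i`!%:R).
  by apply: sumr_ge0 => i _; rewrite mulr_ge0.
move=> y y0; rewrite horner_coef mulr_suml.
apply: (le_trans (ler_norm_sum _ _ _)); apply: ler_sum => i _.
rewrite normrM -mulrA ler_wpM2l// normrX ger0_norm//.
case: (nat_of_ord i) => [|k].
  by rewrite expr0 mul1r -expR0 ler_expR.
rewrite mulrC -ler_pdivrMr ?ltr0n ?fact_gt0//.
by apply: le_trans (expR_ge1Dxn k y0); rewrite lerDr.
Qed.

(** The classical flat function is the case [p = 1]; the polynomial factor makes the family stable
    under derivation. *)
Definition flat_exp p (x : R) : R :=
  if 0 < x then p.[x^-1] * expR (- x^-1) else 0.

(** For positive [x], differentiating [p(1/x) exp(-1/x)] produces the factor [x ^- 2 (p - p')(1/x)],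
    whence the polynomial ['X^2 * (p - p')]. Only the origin needs an estimate. *)
Lemma is_derive_flat_exp p (x : R) :
  is_derive x 1 (flat_exp p) (flat_exp ('X^2 * (p - p^`())) x).
Proof.
have [x0|x0|->] := ltgtP x 0.
- rewrite {2}/flat_exp ltNge (ltW x0)/=.
  apply: (@near_eq_is_derive _ _ _ (cst 0)).
  near=> y; rewrite /flat_exp ltNge.
  suff -> : y <= 0 by [].
  by near: y; exact: lt_le_nbhsl.
- rewrite {2}/flat_exp x0.
  apply: (@near_eq_is_derive _ _ _ (fun y : R => p.[y^-1] * expR (- y^-1))).
  + near=> y; rewrite /flat_exp.
    suff -> : 0 < y by [].
    by near: y; exact: lt_nbhsr.
  + have xn0 : x != 0 by rewrite gt_eqF.
    have dV : is_derive x 1 (fun y : R => y^-1) (- x ^- 2).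
      have h := @is_deriveV _ id x 1 1 xn0 (is_derive_id _ _).
      by apply: is_derive_eq h _; rewrite /GRing.scale/= mulr1.
    have d1 := @is_derive1_comp _ (horner p) _ x _ _ (is_derive_poly _ _) dV.
    have d2 : is_derive x 1 (fun y : R => expR (- y^-1)) (expR (- x^-1) * x ^- 2).
      have dN : is_derive x 1 (fun y : R => - y^-1) (x ^- 2).
        by have := is_deriveN dV; rewrite opprK.
      exact: (@is_derive1_comp _ expR _ x _ _ (is_derive_expR _) dN).
    apply: (is_derive_eq (is_deriveM d1 d2)).
    rewrite /GRing.scale/= !hornerE /= exprVn; field; exact: xn0.
- rewrite {2}/flat_exp ltxx.
  (* The extra ['X^2] yields a bound in [h ^+ 2], so that the difference quotient at 0 is of order
     [h]. *)
  have [C C0 HC] := horner_le_expR ('X^2 * p).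
  have flat_le h : `|flat_exp p h| <= C * h ^+ 2.
    rewrite /flat_exp; case: ifPn => [h0|_]; last by rewrite normr0 mulr_ge0// sqr_ge0.
    have hV : 0 <= h^-1 by rewrite invr_ge0 ltW.
    have HC' : `|p.[h^-1]| <= C * expR h^-1 * h ^+ 2.
      rewrite -ler_pdivrMr ?exprn_gt0// mulrC -exprVn.
      by have := HC _ hV; rewrite !hornerE normrM (ger0_norm (exprn_ge0 _ _)).
    rewrite normrM (ger0_norm (expR_ge0 _)) expRN ler_pdivrMr ?expR_gt0//.
    by rewrite [leRHS]mulrAC.
  have Df : (fun h : R => h^-1 *: (flat_exp p (h *: 1 + 0) - flat_exp p 0)) h @[h --> 0^'] --> 0.
    apply/cvgr0Pnorm_le => e e0; near=> h.
    have hn0 : h != 0 by near: h; exact: nbhs_dnbhs_neq.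
    rewrite [X in _ - X]/flat_exp ltxx subr0 addr0 /GRing.scale/= mulr1 normrM normfV.
    rewrite mulrC ler_pdivrMr ?normr_gt0//.
    rewrite (le_trans (flat_le _))// -real_normK ?num_real// expr2 mulrA.
    rewrite ler_wpM2r//.
    have hlt : `|h| < e / (C + 1) by near: h; apply: dnbhs0_lt; rewrite divr_gt0// ltr_wpDl.
    move: hlt; rewrite ltr_pdivlMr ?ltr_wpDl// mulrDr mulr1 mulrC => /ltW.
    by apply: le_trans; rewrite lerDl.
  split; last by apply: cvg_lim => //.
  by apply/cvg_ex; exists 0.
Unshelve. all: by end_near. Qed.

Lemma smooth_flat_exp p : smooth (flat_exp p).
Proof.
apply: (@smooth_coind (fun f => exists p, f = flat_exp p)); last by exists p.
move=> _ [q ->]; split=> [x|]; first by case: (is_derive_flat_exp q x).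
exists ('X^2 * (q - q^`())); apply/funext => x.
by rewrite derive1E; have [_ ->] := is_derive_flat_exp q x.
Qed.

End smooth.

(** * Smooth approximations of indicators and trapezoidal test functions *)

Section bumps.
Context {R : realType}.
Implicit Types (f g : R -> R).
Local Notation mu := (@lebesgue_measure R).

Lemma flat_exp_itv (x : R) : 0 <= flat_exp 1 x <= 1.
Proof.
rewrite /flat_exp; case: ifPn => [x0|_]; last by rewrite lexx ler01.
by rewrite hornerC mul1r expR_ge0 expR_le1 oppr_le0 invr_ge0 ltW.
Qed.

Lemma flat_exp_le0 (x : R) : x <= 0 -> flat_exp 1 x = 0.
Proof. by rewrite /flat_exp leNgt => /negbTE ->. Qed.

Lemma cvg_flat_exp_dilation (x : R) : 0 < x ->
  flat_exp 1 (n%:R * x) @[n --> \oo] --> (1 : R).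
Proof.
move=> x0.
suff : expR (- (n%:R * x)^-1) @[n --> \oo] --> (1 : R).
  apply: cvg_trans; apply: near_eq_cvg; near=> n.
  rewrite /flat_exp hornerC mul1r.
  suff -> : 0 < n%:R * x by [].
  by rewrite mulr_gt0// ltr0n; near: n; exact: nbhs_infty_gt.
rewrite [X in _ --> X](_ : _ = expR (- 0)); last by rewrite oppr0 expR0.
apply: continuous_cvg; first exact: continuous_expR.
apply: cvgN.
apply/cvgr0Pnorm_le => e e0; near=> n.
have n0 : (0 : R) < n%:R by rewrite ltr0n; near: n; exact: nbhs_infty_gt.
rewrite normfV normrM !gtr0_norm// -[e]invrK lef_pV2 ?posrE ?invr_gt0 ?mulr_gt0//.
rewrite -ler_pdivrMr//; near: n; exact: nbhs_infty_ger.
Unshelve. all: by end_near. Qed.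

(** The arguments are in the form [c * x + d] for the sake of [smooth_affine_comp]; [bumpE] is the
    readable form. The parameter [n] is a steepness: the limit is the indicator of the open
    interval. *)
Definition bump (a b : R) (n : nat) : R -> R :=
  (fun x => flat_exp 1 (n%:R * x + - (n%:R * a))) *
  (fun x => flat_exp 1 (- n%:R * x + n%:R * b)).

Lemma smooth_bump a b n : smooth (bump a b n).
Proof. by apply: smoothM; apply: smooth_affine_comp; exact: smooth_flat_exp. Qed.

Lemma bumpE a b n x :
  bump a b n x = flat_exp 1 (n%:R * (x - a)) * flat_exp 1 (n%:R * (b - x)).
Proof. by rewrite /bump mulrfctE; congr (flat_exp 1 _ * flat_exp 1 _); ring. Qed.

Lemma bump_itv a b n x : 0 <= bump a b n x <= 1.
Proof.
rewrite bumpE; have /andP[? ?] := flat_exp_itv (n%:R * (x - a)).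
have /andP[? ?] := flat_exp_itv (n%:R * (b - x)).
by apply/andP; split; [exact: mulr_ge0|exact: mulr_ile1].
Qed.

Lemma bump_out a b n x : x \notin `]a, b[ -> bump a b n x = 0.
Proof.
rewrite bumpE in_itv/= negb_and -!leNgt => /orP[xa|bx].
  by rewrite flat_exp_le0 ?mul0r// mulr_ge0_le0// subr_le0.
by rewrite mulrC flat_exp_le0 ?mul0r// mulr_ge0_le0// subr_le0.
Qed.

Lemma cvg_bump a b x : x \in `]a, b[ -> bump a b n x @[n --> \oo] --> (1 : R).
Proof.
rewrite in_itv/= => /andP[ax xb].
rewrite [X in _ --> X](_ : _ = 1 * 1); last by rewrite mulr1.
have /cvg_flat_exp_dilation h1 : 0 < x - a by rewrite subr_gt0.
have /cvg_flat_exp_dilation h2 : 0 < b - x by rewrite subr_gt0.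
have -> : (bump a b)^~ x = fun n => flat_exp 1 (n%:R * (x - a)) * flat_exp 1 (n%:R * (b - x)).
  by apply/funext => n; exact: bumpE.
exact: (cvgM h1 h2).
Qed.

Lemma compactly_supported_itv f a b :
  (forall x, x \notin `[a, b] -> f x = 0) -> compactly_supported f.
Proof.
move=> f0; apply: (@subclosed_compact _ _ `[a, b]); last 2 first.
- exact: segment_compact.
- rewrite [X in _ `<=` X](closure_id _).1; last exact: interval_closed.
  by apply: closure_subset => x /=; apply: contra_neqP => /negP /f0.
- exact: closed_closure.
Qed.

Lemma derivable_continuous f : (forall x, derivable f x 1) -> continuous f.
Proof. by move=> df x; apply/differentiable_continuous/derivable1_diffP. Qed.

Lemma smooth_continuous f : smooth f -> continuous f.
Proof. by move=> sf; apply: derivable_continuous => x; exact: (sf 0%N). Qed.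

Lemma continuous_supp_integrable f a b : continuous f ->
  (forall x, x \notin `[a, b] -> f x = 0) ->
  mu.-integrable setT (EFin \o f).
Proof.
move=> cf f0.
have -> : EFin \o f = (EFin \o f) \_ `[a, b].
  apply/funext => x; rewrite patchE; case: ifPn => //.
  by move=> /negP xab; rewrite /= f0//; apply/negP => ?; apply: xab; rewrite inE.
have [h _] := @integrable_mkcond _ _ R mu _ (EFin \o f) (measurable_itv `[a, b]).
apply: h.
apply: continuous_compact_integrable; first exact: segment_compact.
exact: continuous_subspaceT.
Qed.

(** Subtracting from [f] its translate by [d] makes the total integral zero, so the primitive has
    compact support. It climbs on [[a, b]], stays at the mass [c] of [f], and descends on
    [[a + d, b + d]]; [b - a <= d] keeps the two ramps from overlapping. *)
Lemma test_primitive (a b d : R) f : a < b -> b - a <= d -> smooth f ->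
  (forall x, 0 <= f x <= 1) -> (forall x, x \notin `]a, b[ -> f x = 0) ->
  let c := \int[mu]_(x in `[a, b]) f x in
  exists phi : R -> R, [/\ test_function phi,
    derive1 phi = (fun x => f x - f (x - d)),
    (forall x, x \notin `[a, b + d] -> phi x = 0),
    (forall x, x \in `[b, a + d] -> phi x = c) &
    (forall x, 0 <= phi x <= c)].
Proof.
move=> ab bad sf f01 fout c.
have cf := smooth_continuous sf.
have fout' x : x \notin `[a, b] -> f x = 0.
  by move=> xab; apply: fout; apply: contra xab; exact: subset_itv_oo_cc.
have intf := continuous_supp_integrable cf fout'.
(* Integrating from minus infinity gives one formula for the primitive, differentiable at every
   point. *)
pose B z := \int[mu]_(x in `]-oo, z]) f x.
have intfz z : mu.-integrable `]-oo, z] (EFin \o f) by exact: integrableS intf.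
have dB (z : R) : is_derive z 1 B (f z).
  have [] := @continuous_FTC1 R f -oo%O z (z + 1) _ (intfz _) (ltNyr _) (cf z).
    by rewrite ltrDl.
  by move=> ? <-; rewrite derive1E; exact: DeriveDef.
have Ba z : z <= a -> B z = 0.
  move=> za; rewrite /B (@eq_Rintegral _ _ _ _ _ (cst 0)) ?Rintegral_cst ?mul0r//.
  move=> x /[!inE]/=; rewrite in_itv/= => xz; apply: fout.
  by rewrite in_itv/= ltNge (le_trans xz za).
have Bb z : b <= z -> B z = c.
  move=> bz; rewrite /B /c Rintegral_mkcond [RHS]Rintegral_mkcond.
  apply: eq_Rintegral => x _; rewrite !patchE; case: ifPn => xz; case: ifPn => xab//.
    by apply: fout'; apply/negP => xab'; move/negP: xab; apply; rewrite inE.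
  move: xab xz; rewrite inE/= in_itv/= => /andP[_ xb].
  by rewrite notin_setE/= in_itv/= (le_trans xb bz).
have Bhomo x y : x <= y -> B x <= B y.
  move=> xy; rewrite -subr_ge0.
  have [|z _ ->] := @MVT_segment R B f x y xy.
  - apply: continuous_subspaceT; apply: derivable_continuous => z.
    by case: (dB z).
  - by rewrite mulr_ge0 ?subr_ge0//; have /andP[] := f01 z.
have Bc z : 0 <= B z <= c.
  have [/Ba ->|az] := leP z a.
    by rewrite lexx -(Bb b)// -(Ba a)// Bhomo// ltW.
  apply/andP; split; first by rewrite -(Ba a)// Bhomo// ltW.
  by have [/Bb ->//|/ltW zb] := leP b z; rewrite -(Bb b)// Bhomo.
have dphi (x : R) : is_derive x 1 (fun z : R => B z - B (z - d)) (f x - f (x - d)).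
  apply: is_deriveB.
  have := @is_derive_affine_comp _ B 1 (- d) x (f (x - d)).
  rewrite !mul1r => /(_ (dB _)); under eq_fun do rewrite mul1r.
  exact.
have dphiE : derive1 (fun z => B z - B (z - d)) = (fun x => f x - f (x - d)).
  by apply/funext => x; rewrite derive1E derive_val.
exists (fun z => B z - B (z - d)); split.
- split; last first.
    apply: (@compactly_supported_itv _ a (b + d)) => x.
    rewrite in_itv/= negb_and -!ltNge => /orP[xa|bx].
      by rewrite !Ba ?subrr ?ltW//; lra.
    by rewrite !Bb ?subrr ?ltW//; lra.
  case=> [|n] x; first by case: (dphi x).
  rewrite derive1Sn dphiE; move: n x; change (smooth (fun x => f x - f (x - d))).
  have -> : (fun x => f x - f (x - d)) = f + (fun x => - 1 * f (1 * x + - d)).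
    by apply/funext => x; rewrite addrfctE mul1r mulN1r.
  apply/smoothP => n; apply: derivable_uptoD; first exact: ((smoothP _).1 sf).
  by apply: derivable_uptoZ; apply: ((smoothP _).1 _); exact: smooth_affine_comp.
- exact: dphiE.
- move=> x; rewrite in_itv/= negb_and -!ltNge => /orP[xa|bx].
    by rewrite !Ba ?subrr ?ltW//; lra.
  by rewrite !Bb ?subrr ?ltW//; lra.
- by move=> x; rewrite in_itv/= => /andP[bx xa]; rewrite Bb// Ba ?subr0//; lra.
- move=> x; have [xa|xa] := leP (x - d) a.
    by rewrite (Ba _ xa) subr0.
  rewrite (@Bb x); last lra.
  by have /andP[? ?] := Bc (x - d); rewrite subr_ge0 lerBlDr lerDl; apply/andP.
Qed.

End bumps.

(** * Weak derivatives *)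

Section du_bois_reymond.
Context {R : realType}.
Implicit Types (f g : R -> R).
Local Notation mu := (@lebesgue_measure R).

Lemma integrableZl_EFin (D : set R) f (c : R) : measurable D ->
  mu.-integrable D (EFin \o f) -> mu.-integrable D (EFin \o (fun x => c * f x)).
Proof. by move=> mD fD; exact: (@integrableZl _ _ _ mu D mD c (EFin \o f)). Qed.

Lemma integrableD_EFin (D : set R) f g : measurable D ->
  mu.-integrable D (EFin \o f) -> mu.-integrable D (EFin \o g) ->
  mu.-integrable D (EFin \o (fun x => f x + g x)).
Proof.
by move=> mD fD gD; exact: (@integrableD _ _ _ mu D mD (EFin \o f) (EFin \o g)).
Qed.

(** Unlike square integrability, this holds for constants too, so that the lemma on bumps also
    computes the limit of their masses. *)
Definition itv_integrable f :=
  forall x y, mu.-integrable `[x, y] (EFin \o f).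

Lemma square_integrable_measurable f :
  square_integrable f -> measurable_fun setT f.
Proof. by rewrite /square_integrable inE => /andP[/[!inE]]. Qed.

(** On a set of finite measure, [1 + f ^+ 2] is integrable and dominates [|f|]. *)
Lemma square_integrable_integrable f (D : set R) : square_integrable f ->
  measurable D -> (mu D < +oo)%E -> mu.-integrable D (EFin \o f).
Proof.
move=> sf mD Doo.
have i1 : mu.-integrable D (EFin \o (fun x => 1 + f x ^+ 2)).
  apply: (@integrableD _ _ _ mu D mD (EFin \o cst 1) (EFin \o (fun x => f x ^+ 2))).
    by apply: measurable_bounded_integrable => //; exact: bounded_cst.
  apply: (@integrableS _ _ _ mu setT) => //; exact: Lfun2_integrable_sqr.
apply: le_integrable i1 => //.
  apply/measurable_EFinP; apply: measurable_funS (square_integrable_measurable sf) => //.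
move=> x _ /=; rewrite lee_fin [leRHS]ger0_norm ?addr_ge0 ?sqr_ge0//.
rewrite -real_normK ?num_real//.
have := sqr_ge0 (`|f x| - 1); have := normr_ge0 (f x); nra.
Qed.

Lemma square_integrable_itv f : square_integrable f -> itv_integrable f.
Proof.
move=> sf x y; apply: square_integrable_integrable => //.
exact/compact_finite_measure/segment_compact.
Qed.

Lemma square_integrable_locally f :
  square_integrable f -> locally_integrable setT f.
Proof.
move=> sf; split; [exact: square_integrable_measurable|exact: openT|].
move=> K _ cK.
have mK : measurable K by exact: compact_measurable.
have /integrableP[_] := square_integrable_integrable sf mK (compact_finite_measure cK).
by [].
Qed.

Lemma itv_integrable_norm f : itv_integrable f -> itv_integrable (fun x => `|f x|).
Proof. by move=> sf x y; apply: integrable_norm; exact: sf. Qed.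

Lemma itv_integrable_chasles f x y z : itv_integrable f -> x <= y -> y <= z ->
  \int[mu]_(t in `[x, z]) f t =
  \int[mu]_(t in `[x, y]) f t + \int[mu]_(t in `[y, z]) f t.
Proof.
move=> sf xy yz; apply/eqP; rewrite addrC -subr_eq; apply/eqP.
rewrite (@Rintegral_itvB R f (BLeft x) (BRight z)) ?bnd_simp//.
rewrite Rintegral_itv_obnd_cbnd//; apply: integrableS (sf y z) => //.
exact: subset_itv_oc_cc.
Qed.

Lemma itv_integral_sub f x y z : itv_integrable f -> x <= y -> y <= z ->
  \int[mu]_(t in `[x, z]) f t - \int[mu]_(t in `[x, y]) f t =
  \int[mu]_(t in `[y, z]) f t.
Proof. by move=> lf xy yz; rewrite (itv_integrable_chasles lf xy yz) addrAC subrr add0r. Qed.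

Lemma bump_shift a b d n x : bump a b n (x - d) = bump (a + d) (b + d) n x :> R.
Proof. by rewrite !bumpE; congr (flat_exp 1 _ * flat_exp 1 _); ring. Qed.

Lemma Rintegral_supp f (D : set R) : (forall x, ~ D x -> f x = 0) ->
  \int[mu]_x f x = \int[mu]_(x in D) f x.
Proof.
move=> f0; rewrite [RHS]Rintegral_mkcond; apply: eq_Rintegral => x _.
by rewrite patchE; case: ifPn => //; rewrite notin_setE => /f0.
Qed.

(** Dominated convergence with bound [|f|], on the open interval: the bumps vanish at the endpoints,
    so there they do not tend to 1. *)
Lemma cvg_integral_bump f a b : itv_integrable f -> a < b ->
  \int[mu]_x (f x * bump a b n x) @[n --> \oo] --> \int[mu]_(x in `[a, b]) f x.
Proof.
move=> sf ab.
have sfo : mu.-integrable `]a, b[ (EFin \o f).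
  by apply: integrableS (sf a b) => //; exact: subset_itv_oo_cc.
have -> : \int[mu]_(x in `[a, b]) f x = \int[mu]_(x in `]a, b[) f x.
  rewrite Rintegral_itv_bndo_bndc//?Rintegral_itv_obnd_cbnd//.
    apply: integrableS (sf a b) => //; exact: subset_itv_oc_cc.
have suppE n : \int[mu]_x (f x * bump a b n x) = \int[mu]_(x in `]a, b[) (f x * bump a b n x).
  apply: Rintegral_supp => x xab; rewrite bump_out ?mulr0//.
  by apply/negP => xab'; apply: xab.
under eq_fun do rewrite suppE.
have [] := @dominated_convergence _ _ _ mu `]a, b[%classic (measurable_itv _)
  (fun n x => (f x * bump a b n x)%:E) (EFin \o f) (fun x => `|f x|%:E).
- move=> n; apply/measurable_EFinP; apply: measurable_funM.
    by case/integrableP : sfo => /measurable_EFinP.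
  apply: measurable_funTS; apply: continuous_measurable_fun.
  exact/smooth_continuous/smooth_bump.
- by case/integrableP : sfo.
- apply: aeW => x xab; apply: cvg_EFin; first exact: nearW.
  rewrite [X in _ --> X](_ : _ = f x * 1); last by rewrite mulr1.
  by apply: cvgM; [exact: cvg_cst|exact: cvg_bump].
- exact: integrable_norm.
- apply: aeW => x n _; rewrite lee_fin normrM.
  have /andP[b0 b1] := bump_itv a b n x.
  by rewrite (ger0_norm b0) ler_piMr.
- move=> _ _ h; apply: fine_cvg.
  rewrite fineK//; last exact: integrable_fin_num sfo.
Qed.

Definition weak_pair f g := forall phi : R -> R, test_function phi ->
  \int[mu]_x (f x * derive1 phi x) = - \int[mu]_x (g x * phi x).

Local Notation itg f x y := (\int[mu]_(t in `[x, y]) f t).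

Lemma itv_integrable_mul f g (C : R) : itv_integrable f -> measurable_fun setT g ->
  (forall x, `|g x| <= C) -> itv_integrable (fun x => f x * g x).
Proof.
move=> sf mg gC a b.
have iC : mu.-integrable `[a, b] (EFin \o (fun x => C * f x)) by exact: integrableZl_EFin.
apply: le_integrable iC => //.
  apply/measurable_EFinP; apply: measurable_funM; last exact: measurable_funTS.
  by case/integrableP : (sf a b) => /measurable_EFinP.
move=> x _; rewrite /= lee_fin !normrM mulrC ler_wpM2r//.
by rewrite (le_trans (gC x))// ler_norm.
Qed.

Lemma integrable_supp f a b : itv_integrable f ->
  (forall x, x \notin `[a, b] -> f x = 0) -> mu.-integrable setT (EFin \o f).
Proof.
move=> sf f0.
have [h _] := @integrable_mkcond _ _ R mu _ (EFin \o f) (measurable_itv `[a, b]).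
have -> : EFin \o f = (EFin \o f) \_ `[a, b].
  apply/funext => x; rewrite patchE; case: ifPn => //.
  by move=> /negP xab; rewrite /= f0//; apply/negP => ?; apply: xab; rewrite inE.
by apply: h; exact: sf.
Qed.

Lemma continuous_measurable f : continuous f -> measurable_fun setT f.
Proof. by move=> cf; exact: continuous_measurable_fun. Qed.

(* The primitive of [bump(x) - bump(x - d)] is a smooth trapezoid, which tends to
   [e] times the indicator of [a, a + d] up to two strips of width [e]. *)
Lemma weak_pair_bump f g a d e : itv_integrable f -> itv_integrable g ->
  weak_pair f g -> 0 < e <= d ->
  `|itg f a (a + e) - itg f (a + d) (a + d + e) + e * itg g a (a + d + e)| <=
  e * (itg (fun x => `|g x|) a (a + e) + itg (fun x => `|g x|) (a + d) (a + d + e)).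
Proof.
move=> lf lg fg /andP[e0 ed].
pose b := bump a (a + e); pose c n := itg (b n) a (a + e).
have ae : a < a + e by rewrite ltrDl.
have ade : a + d < a + d + e by rewrite ltrDl.
pose J n := \int[mu]_x (f x * b n x).
pose K n := \int[mu]_x (f x * bump (a + d) (a + d + e) n x).
pose E := itg (fun x => `|g x|) a (a + e) + itg (fun x => `|g x|) (a + d) (a + d + e).
pose G := itg g a (a + d + e).
have cJ : J n @[n --> \oo] --> itg f a (a + e) by exact: cvg_integral_bump.
have cK : K n @[n --> \oo] --> itg f (a + d) (a + d + e) by exact: cvg_integral_bump.
have cc : c n @[n --> \oo] --> e.
  have h : itv_integrable (cst 1).
    move=> x y; apply: continuous_compact_integrable; first exact: segment_compact.
    by apply: continuous_subspaceT => ?; exact: cvg_cst.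
  have := cvg_integral_bump h ae.
  have -> : \int[mu]_(x in `[a, a + e]) (cst 1 x : R) = e.
    have -> := @Rintegral_cst _ _ _ mu `[a, a + e]%classic (measurable_itv _) 1.
    rewrite mul1r [X in fine X](_ : _ = e%:E)//= lebesgue_measure_itv/= lte_fin ae -EFinD/=.
    by rewrite addrAC subrr add0r.
  apply: cvg_trans; apply: near_eq_cvg; apply: nearW => n.
  under eq_Rintegral do rewrite mul1r.
  apply: Rintegral_supp => x xab; apply: bump_out; apply/negP => xab'; apply: xab.
  exact: subset_itv_oo_cc xab'.
(* Before any limit: for the trapezoid [phi], [J n - K n] is the integral of [f * phi'], that is
   minus the integral of [g * phi]. The left-hand side is thus the integral of [g * (c n - phi)],
   where [c n - phi] vanishes on the plateau and lies between 0 and [c n] on the ramps. *)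
have main n : `|J n - K n + c n * G| <= c n * E.
  have aed : a + e - a <= d by rewrite addrAC subrr add0r.
  have [phi [tphi dphi phi0 phic phi0c]] := test_primitive ae aed
    (@smooth_bump R a (a + e) n) (bump_itv a (a + e) n) (@bump_out _ a (a + e) n).
  rewrite -/(c n) addrAC in phi0 phic phi0c.
  have cphi : continuous phi by apply: smooth_continuous; case: tphi.
  have intb x : mu.-integrable setT (EFin \o (fun t => f t * bump x (x + e) n t)).
    apply: (@integrable_supp _ x (x + e)) => [|y xy].
    - apply: (@itv_integrable_mul _ _ 1) => // [|y].
        by apply: continuous_measurable; apply: smooth_continuous; exact: smooth_bump.
      by have /andP[? ?] := bump_itv x (x + e) n y; rewrite ger0_norm.
    - rewrite bump_out ?mulr0//; apply: contra xy; exact: subset_itv_oo_cc.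
  have JK : J n - K n = - \int[mu]_x (g x * phi x).
    rewrite -fg// dphi /J /K -RintegralB//.
      apply: eq_Rintegral => x _; rewrite /b bump_shift mulrBr.
      by rewrite [a + e + d]addrAC.
    exact: intb.
  pose D := `[a, a + d + e]%classic : set R.
  have mD : measurable D by exact: measurable_itv.
  have iD h : itv_integrable h -> mu.-integrable D (EFin \o h) by exact.
  have phin x : `|phi x| <= c n by have /andP[? ?] := phi0c x; rewrite ger0_norm.
  have cphin x : `|c n - phi x| <= c n.
    by have /andP[? ?] := phi0c x; rewrite ger0_norm ?subr_ge0// gerBl.
  have igphi : mu.-integrable D (EFin \o (fun x => g x * phi x)).
    by apply: iD; apply: itv_integrable_mul phin => //; exact: continuous_measurable.
  have igc : mu.-integrable D (EFin \o (fun x => g x * (c n - phi x))).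
    apply: iD; apply: itv_integrable_mul cphin => //; apply: continuous_measurable.
    by move=> x; apply: cvgB; [exact: cvg_cst|exact: cphi].
  have -> : J n - K n + c n * G = \int[mu]_(x in D) (g x * (c n - phi x)).
    rewrite JK (@Rintegral_supp _ D); last first.
      by move=> x Dx; rewrite phi0 ?mulr0//; apply/negP.
    rewrite /G -RintegralZl//.
    rewrite addrC -RintegralB//; last exact/integrableZl_EFin/lg.
    by apply: eq_Rintegral => x _; ring.
  apply: le_trans (le_normr_Rintegral _ igc) _ => //.
  (* [|g|] cut down to a strip but integrated over all of [D], so that the estimate becomes a
     pointwise comparison. *)
  pose r (u v : R) := (fun x => `|g x|) \_ `[u, v].
  have lng := itv_integrable_norm lg.
  have rE u v x : x \in `[u, v] -> r u v x = `|g x|.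
    by move=> xuv; rewrite /r patchE mem_set.
  have r0 u v x : 0 <= r u v x by rewrite /r patchE; case: ifPn.
  have ir u v : mu.-integrable D (EFin \o r u v).
    have [+ _] := @integrable_restrict _ _ R mu `[u, v]%classic (measurable_itv _)
      D (measurable_itv _) (fun x => `|g x|%:E).
    rewrite restrict_EFin; apply; apply: (@integrableS _ _ _ mu D) => //.
    - exact: measurableI.
    - exact: iD.
  have rI u v : a <= u -> v <= a + d + e -> \int[mu]_(x in D) r u v x = itg (fun x => `|g x|) u v.
    move=> au va; rewrite /r -Rintegral_mkcondr setIidr//.
    by apply: subset_itv; rewrite bnd_simp.
  have -> : c n * E = \int[mu]_(x in D) (c n * (r a (a + e) x + r (a + d) (a + d + e) x)).
    rewrite RintegralZl//; last exact: integrableD_EFin.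
    by rewrite RintegralD// !rI// ?lerD2r; lra.
  apply: le_Rintegral => //.
  - exact: integrable_norm.
  - by apply: integrableZl_EFin => //; exact: integrableD_EFin.
  - move=> x; rewrite /D/= in_itv/= => /andP[ax xa].
    have /andP[p0 pc] := phi0c x.
    have cp0 : 0 <= c n - phi x by rewrite subr_ge0.
    rewrite normrM (ger0_norm cp0) mulrC.
    have [xae|xae] := leP x (a + e).
      rewrite (@rE a); last by rewrite in_itv/= ax.
      by apply: ler_pM => //; rewrite ?gerBl// lerDl.
    have [xad|xad] := leP (a + d) x.
      rewrite (@rE (a + d)); last by rewrite in_itv/= xad.
      by apply: ler_pM => //; rewrite ?gerBl// lerDr.
    rewrite phic ?subrr ?mul0r; last by rewrite in_itv/= !ltW.
    rewrite mulr_ge0//; first exact: le_trans pc.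
    by rewrite addr_ge0.
apply: (@ler_cvg_to _ \oo _ _ (fun n => `|J n - K n + c n * G|) (fun n => c n * E)).
- apply: cvg_norm; apply: cvgD; first exact: cvgB.
  by apply: cvgM => //; exact: cvg_cst.
- by apply: cvgM => //; exact: cvg_cst.
- exact: nearW.
Qed.

Lemma itv_integral_continuous f A x : itv_integrable f -> A < x ->
  {for x, continuous (fun y => itg f A y)}.
Proof.
move=> lf Ax.
have Ax1 : A < x + 1 by rewrite (lt_trans Ax)// ltrDl.
have := parameterized_integral_continuous (ltW Ax1) (lf A (x + 1)).
move=> /(within_continuous_continuous Ax1); apply.
by rewrite in_itv/= Ax ltrDl/=.
Qed.

(* Divide [weak_pair_bump] by [e] and let [e] tend to 0. *)
Lemma weak_pair_increment f g a b : itv_integrable f -> itv_integrable g ->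
  weak_pair f g -> a < b -> lebesgue_pt f a -> lebesgue_pt f b ->
  f b - f a = itg g a b.
Proof.
move=> lf lg fg ab fa fb.
(* A base point strictly to the left of [a] makes both [a] and [b] interior points for the
   primitives. *)
pose A := a - 1; pose F y := itg f A y; pose Q y := itg g A y.
pose P y := itg (fun x => `|g x|) A y.
have lng := itv_integrable_norm lg.
have Aa : A < a by rewrite /A ltrBlDr ltrDl.
have Ab : A < b by exact: lt_trans ab.
have dF x : A < x -> lebesgue_pt f x -> (e^-1 * (F (x + e) - F x)) @[e --> 0^'+] --> f x.
  move=> Ax fx.
  have x1 : x < x + 1 by rewrite ltrDl.
  have Axb : (BLeft A < BRight x)%E by rewrite lte_fin.
  have [h1 h2] := FTC1_lebesgue_pt x1 (lf A (x + 1)) Axb fx.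
  apply: cvg_dnbhs_at_right; move/cvg_ex: h1 => [l hl].
  have lE : l = f x.
    rewrite -h2; apply/esym/cvg_lim => //.
    by move: hl; under eq_fun do rewrite scaler1.
  move: hl; rewrite lE; apply: cvg_trans; apply: near_eq_cvg; apply: nearW => e /=.
  by rewrite /F [x + e]addrC /GRing.scale/= mulr1.
have cQ h x : itv_integrable h -> A < x -> (itg h A (x + e)) @[e --> 0^'+] --> itg h A x.
  move=> ih Ax; apply: cvg_at_right_filter.
  have xe : x + e @[e --> (0 : R)] --> x.
    by rewrite -[X in _ --> X]addr0; apply: cvgD; [exact: cvg_cst|exact: cvg_id].
  exact: (cvg_comp (fun e => x + e) (fun y => itg h A y) xe (itv_integral_continuous ih Ax)).
(* The right-hand side consists of increments of [P] over strips of width [e]; it tends to 0 because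
   [P] is continuous. *)
have {}main : \forall e \near 0^'+,
   `|e^-1 * (F (a + e) - F a) - e^-1 * (F (b + e) - F b) + (Q (b + e) - Q a)| <=
   (P (a + e) - P a) + (P (b + e) - P b).
  near=> e.
  have e0 : 0 < e by near: e; exact: nbhs_right_gt.
  have eab : e <= b - a by near: e; apply: nbhs_right_le; rewrite subr_gt0.
  have := @weak_pair_bump f g a (b - a) e lf lg fg; rewrite e0 eab => /(_ isT).
  rewrite (addrC a (b - a)) subrK /F /Q /P.
  have ae : a <= a + e by rewrite lerDl ltW.
  have be : b <= b + e by rewrite lerDl ltW.
  have abe : a <= b + e by rewrite (le_trans (ltW ab)).
  rewrite (itv_integral_sub lf (ltW Aa) ae) (itv_integral_sub lf (ltW Ab) be).
  rewrite (itv_integral_sub lg (ltW Aa) abe) (itv_integral_sub lng (ltW Aa) ae).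
  rewrite (itv_integral_sub lng (ltW Ab) be).
  move: (itg f a _) (itg f b _) (itg g a _) => x y z; set w := (X in _ -> _ <= X) => h.
  rewrite -(ler_pM2l e0); apply: le_trans h.
  rewrite -[X in X * _ <= _](gtr0_norm e0) -normrM mulrDr mulrBr !mulrA.
  by rewrite divff ?gt_eqF// !mul1r.
have : `|f a - f b + (Q b - Q a)| <= (P a - P a) + (P b - P b).
  apply: (ler_cvg_to _ _ main).
  - apply: cvg_norm; apply: cvgD; [apply: cvgB; exact: dF|].
    by apply: cvgB; [exact: cQ|exact: cvg_cst].
  - by apply: cvgD; apply: cvgB; (try exact: cvg_cst); exact: cQ.
rewrite !subrr addr0 normr_le0 => /eqP.
by rewrite /Q itv_integral_sub ?ltW// => h; lra.
Unshelve. all: by end_near. Qed.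

End du_bois_reymond.

(** * Square integrable functions up to null sets *)

Section square_integrable.
Context {R : realType}.
Implicit Types (f g : R -> R).
Local Notation mu := (@lebesgue_measure R).

Lemma ae_imply (P Q : R -> Prop) : (forall x, P x -> Q x) ->
  {ae mu, forall x, P x} -> {ae mu, forall x, Q x}.
Proof.
by move=> PQ; apply: filterS => //; exact: (ae_filter_ringOfSetsType mu).
Qed.

Lemma ae_imply2 (P Q S : R -> Prop) : (forall x, P x -> Q x -> S x) ->
  {ae mu, forall x, P x} -> {ae mu, forall x, Q x} -> {ae mu, forall x, S x}.
Proof.
by move=> PQ; apply: filterS2 => //; exact: (ae_filter_ringOfSetsType mu).
Qed.

Lemma Lnorm2_poweR f :
  ('N[mu]_2%:E[EFin \o f] `^ 2 = \int[mu]_x ((f x) ^+ 2)%:E)%E.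
Proof.
rewrite poweR_Lnorm//; apply: eq_integral => x _.
by rewrite /= powR_mulrn// real_normK ?num_real.
Qed.

Lemma square_integrableP f : square_integrable f <->
  measurable_fun setT f /\ mu.-integrable setT (fun x => (f x ^+ 2)%:E).
Proof.
split=> [sf|[mf if2]].
  by split; [exact: square_integrable_measurable|exact: Lfun2_integrable_sqr].
rewrite /square_integrable inE; apply/andP; split; rewrite inE//=.
rewrite /finite_norm; apply: (@lty_poweRy _ _ 2) => //.
by rewrite Lnorm2_poweR; exact: integrable_lty if2.
Qed.

Lemma ae_exists (P : R -> Prop) : {ae mu, forall x, P x} -> exists x, P x.
Proof.
move=> [N [mN N0 PN]]; apply: contrapT => /forallNP nP.
have NT : N = setT by apply/seteqP; split=> // x _; exact: PN (nP x).
have : (mu `[0%R, 1%R]%classic <= mu N)%E.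
  by apply: le_measure; rewrite ?inE// NT.
by rewrite N0 lebesgue_measure_itv/= lte_fin ltr01 oppr0 adde0 lee_fin ler10.
Qed.

(** The set where two continuous functions differ is open; if nonempty it contains an interval of
    positive length, which no null set does. *)
Lemma continuous_ae_eq f g : continuous f -> continuous g ->
  {ae mu, forall x, f x = g x} -> f = g.
Proof.
move=> cf cg [N [mN N0 fgN]]; apply/funext => x; apply: contrapT => fgx.
have : \forall y \near x, f y - g y != 0.
  have : f y - g y @[y --> x] --> f x - g x by apply: cvgB; [exact: cf|exact: cg].
  move=> /cvgr_neq0; apply; rewrite subr_eq0; exact/eqP.
move=> [e /= e0 he].
have sub : `]x - e, x + e[ `<=` N.
  move=> y /=; rewrite in_itv/= => xye; apply: fgN => fgy.
  have /eqP : f y - g y != 0 by apply: he; rewrite /ball_/= ltr_distlC.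
  by rewrite [f y]fgy subrr.
have : (mu `](x - e)%R, (x + e)%R[%classic <= mu N)%E by apply: le_measure; rewrite ?inE.
rewrite N0 lebesgue_measure_itv/= lte_fin ifT; last by move: e0; clear; lra.
rewrite -EFinB lee_fin; move: e0; clear; lra.
Qed.

Lemma square_integrable_ae f g : square_integrable f -> measurable_fun setT g ->
  {ae mu, forall x, f x = g x} -> square_integrable g.
Proof.
move=> /square_integrableP[mf if2] mg fg; apply/square_integrableP; split=> //.
have mg2 : measurable_fun setT (fun x => (g x ^+ 2)%:E).
  by apply/measurable_EFinP; exact: measurable_funX.
have /integrableP[mf2 foo] := if2; apply/integrableP; split=> //.
rewrite -(_ : \int[mu]_x `|(f x ^+ 2)%:E| = \int[mu]_x `|(g x ^+ 2)%:E|)%E//.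
apply: ae_eq_integral => //.
- exact: measurableT_comp.
- exact: measurableT_comp.
- by apply: ae_imply fg => x /= ->.
Qed.

Lemma Lnorm2_ae f g : measurable_fun setT f -> measurable_fun setT g ->
  {ae mu, forall x, f x = g x} ->
  'N[mu]_2%:E[EFin \o f]%E = 'N[mu]_2%:E[EFin \o g]%E.
Proof.
move=> mf mg fg.
have E h : 'N[mu]_2%:E[EFin \o h]%E = ((\int[mu]_x (h x ^+ 2)%:E) `^ (2^-1))%E.
  by rewrite -Lnorm2_poweR -poweRrM mulfV// poweRe1// Lnorm_ge0.
rewrite !E; congr (_ `^ _)%E; apply: ae_eq_integral => //.
- by apply/measurable_EFinP; exact: measurable_funX.
- by apply/measurable_EFinP; exact: measurable_funX.
- by apply: ae_imply fg => x /= ->.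
Qed.

Lemma Rintegral_ae (D : set R) f g : measurable D ->
  measurable_fun D f -> measurable_fun D g ->
  {ae mu, forall x, f x = g x} -> \int[mu]_(x in D) f x = \int[mu]_(x in D) g x.
Proof.
move=> mD mf mg fg; congr fine; apply: ae_eq_integral => //.
- exact/measurable_EFinP.
- exact/measurable_EFinP.
- by apply: ae_imply fg => x /= ->.
Qed.

Lemma square_integrable_lin f g (a b : R) : square_integrable f ->
  square_integrable g -> square_integrable (fun x => a * f x + b * g x).
Proof.
move=> /square_integrableP[mf if2] /square_integrableP[mg ig2].
have m : measurable_fun setT (fun x => a * f x + b * g x).
  by apply: measurable_funD; apply: measurable_funM.
apply/square_integrableP; split=> //.
(* Domination by [(a f + b g)^2 <= 2 a^2 f^2 + 2 b^2 g^2]. *)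
apply: (@le_integrable _ _ _ mu _ _ _
  (EFin \o (fun x => (2 * a ^+ 2) * f x ^+ 2 + (2 * b ^+ 2) * g x ^+ 2))) => //.
- by apply/measurable_EFinP; exact: measurable_funX.
- move=> x _ /=; rewrite lee_fin (ger0_norm (sqr_ge0 _)).
  apply: le_trans (ler_norm _).
  have := sqr_ge0 (a * f x - b * g x); rewrite -subr_ge0 => h.
  rewrite -subr_ge0; apply: le_trans h _; rewrite le_eqVlt; apply/orP; left.
  by apply/eqP; ring.
- by apply: integrableD_EFin => //; apply: integrableZl_EFin.
Qed.

Lemma square_integrable_mul f g : square_integrable f -> square_integrable g ->
  mu.-integrable setT (EFin \o (fun x => f x * g x)).
Proof. by move=> sf sg; apply/Lfun1_integrable; exact: Lfun2_mul_Lfun1. Qed.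

End square_integrable.

(** * Continuous representatives and uniqueness of weak derivatives *)

Section weak_derivative.
Context {R : realType}.
Implicit Types (f g : R -> R).
Local Notation mu := (@lebesgue_measure R).

Lemma compactly_supported_bounded f : compactly_supported f ->
  exists2 M : R, 0 < M & forall x, M < `|x| -> f x = 0.
Proof.
move=> /compact_bounded[M [Mr hM]].
exists (`|M| + 1); first by rewrite ltr_wpDl.
move=> x Mx; apply: contrapT => /eqP fx0.
have MM : M < `|M| + 1 by rewrite (le_lt_trans (ler_norm _))// ltrDl.
have cx : closure [set y | f y != 0] x by exact: subset_closure.
have /= := hM _ MM x cx.
by rewrite leNgt Mx.
Qed.

Lemma test_function_square_integrable (phi : R -> R) : test_function phi ->
  square_integrable phi /\ square_integrable (derive1 phi).
Proof.
move=> [sphi /compactly_supported_bounded[M M0 phi0]].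
have sq h : continuous h -> (forall x, x \notin `[- M, M] -> h x = 0) -> square_integrable h.
  move=> ch h0; apply/square_integrableP; split; first exact: continuous_measurable.
  apply: (@continuous_supp_integrable _ (fun x => h x ^+ 2) (- M) M).
    by move=> x; apply: cvgM; exact: ch.
  by move=> x /h0 ->; rewrite expr0n.
have phi0' x : x \notin `[- M, M] -> M < `|x|.
  by rewrite in_itv/= -ler_norml -ltNge.
split; apply: sq.
- exact: smooth_continuous.
- by move=> x /phi0'; exact: phi0.
- by apply: derivable_continuous => x; exact: (sphi 1%N).
(* The strict inequality [M < |x|] is an open condition, so [phi] vanishes in a whole neighbourhood
   of [x]. *)
- move=> x /phi0' Mx; rewrite derive1E (@near_eq_derive _ _ _ _ (cst 0)) ?derive_cst//.
  have : \forall y \near x, M < `|y|.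
    have : `|y| @[y --> x] --> `|x| by apply: cvg_norm; exact: cvg_id.
    by move=> /cvgr_gt; apply.
  by apply: filterS => y /phi0.
Qed.

(** [F] is the primitive of [g] that agrees with [f] at one Lebesgue point [c]. By
    [weak_pair_increment] it agrees with [f] at all Lebesgue points, hence almost everywhere. *)
Lemma continuous_rep f g : square_integrable f -> is_weak_derive f g ->
  exists F : R -> R, [/\ continuous F, {ae mu, forall x, f x = F x} &
    forall x y, x <= y -> F y - F x = \int[mu]_(t in `[x, y]) g t].
Proof.
move=> sf [sg fg].
have lf := square_integrable_itv sf; have lg := square_integrable_itv sg.
have leb := lebesgue_differentiation (square_integrable_locally sf).
have [c lc] := ae_exists leb.
pose I x y := \int[mu]_(t in `[x, y]) g t.
pose F x := f c + (if c <= x then I c x else - I x c).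
have Icc x : I x x = 0 by rewrite /I set_itv1 Rintegral_set1.
have IFE x y : x <= y -> F y - F x = I x y.
  move=> xy; rewrite /F opprD addrACA subrr add0r.
  have [cx|/ltW xc] := leP c x.
    by rewrite (le_trans cx xy) itv_integral_sub.
  have [cy|/ltW yc] := leP c y.
    by rewrite opprK addrC /I -itv_integrable_chasles.
  by rewrite opprK addrC /I (itv_integrable_chasles lg xy yc) addrK.
exists F; split.
- move=> x; pose A := x - 1.
  have Ax : A < x by rewrite ltrBlDr ltrDl.
  have h : F A + I A y @[y --> x] --> F A + I A x.
    by apply: cvgD; [exact: cvg_cst|exact: itv_integral_continuous].
  have FE y : A <= y -> F y = F A + I A y.
    by move=> Ay; rewrite -IFE// addrC subrK.
  rewrite /continuous_at (FE x) ?ltW//; apply: cvg_trans h.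
  apply: near_eq_cvg; near=> y; rewrite -FE//; apply: ltW.
  by near: y; exact: lt_nbhsr.
- apply: ae_imply leb => x lx; rewrite /F.
  have [|cx|<-] := ltgtP c x.
  + by move=> cx; rewrite /I -(weak_pair_increment lf lg fg cx lc lx) addrC subrK.
  + by rewrite /I -(weak_pair_increment lf lg fg cx lx lc) opprB addrC subrK.
  + by rewrite Icc addr0.
- exact: IFE.
Unshelve. all: by end_near. Qed.

(** Both continuous representatives of [f] coincide, so [g] and [g'] have the same increments of
    primitives; differentiating these at a common Lebesgue point gives [g x = g' x]. *)
Lemma weak_derive_unique f g g' : square_integrable f ->
  is_weak_derive f g -> is_weak_derive f g' -> {ae mu, forall x, g x = g' x}.
Proof.
move=> sf fg fg'.
have [F [cF fF Fg]] := continuous_rep sf fg.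
have [F' [cF' fF' Fg']] := continuous_rep sf fg'.
have FF' : F = F'.
  by apply: continuous_ae_eq => //; apply: ae_imply2 fF fF' => x <-.
have [sg _] := fg; have [sg' _] := fg'.
have leb := lebesgue_differentiation (square_integrable_locally sg).
have leb' := lebesgue_differentiation (square_integrable_locally sg').
apply: ae_imply2 leb leb' => x lx lx'.
have x1 : x < x + 1 by rewrite ltrDl.
have Axb : (BLeft (x - 1)%R < BRight x)%E by rewrite lte_fin ltrBlDr ltrDl.
have [_ <-] := FTC1_lebesgue_pt x1 (square_integrable_itv sg (x - 1) (x + 1)) Axb lx.
have [_ <-] := FTC1_lebesgue_pt x1 (square_integrable_itv sg' (x - 1) (x + 1)) Axb lx'.
congr (derive1 _ x); apply/funext => y.
have [xy|xy] := leP (x - 1) y; first by rewrite -Fg// -Fg'// FF'.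
(* To the left of the base point the segments are empty and both integrals are 0. *)
by rewrite !set_itv_ge ?Rintegral_set0// bnd_simp -ltNge.
Qed.

Lemma is_weak_derive_ae f f' g g' : square_integrable f -> square_integrable f' ->
  square_integrable g' -> {ae mu, forall x, f x = f' x} ->
  {ae mu, forall x, g x = g' x} -> is_weak_derive f g -> is_weak_derive f' g'.
Proof.
move=> sf sf' sg' ff' gg' [sg fg]; split=> // phi tphi.
have [/square_integrable_measurable mp /square_integrable_measurable mp'] :=
  test_function_square_integrable tphi.
rewrite -(@Rintegral_ae _ setT (fun x => f x * derive1 phi x))//; last 3 first.
- by apply: measurable_funM => //; exact: square_integrable_measurable.
- by apply: measurable_funM => //; exact: square_integrable_measurable.
- by apply: ae_imply ff' => x ->.
rewrite -(@Rintegral_ae _ setT (fun x => g x * phi x) (fun x => g' x * phi x))//.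
- exact: fg.
- by apply: measurable_funM => //; exact: square_integrable_measurable.
- by apply: measurable_funM => //; exact: square_integrable_measurable.
- by apply: ae_imply gg' => x ->.
Qed.

(** Functions equal almost everywhere have the same set of weak derivatives, so the choice returns
    literally the same function. This is what allows [weak_derive] to be iterated on another
    representative. *)
Lemma weak_derive_ae f f' : square_integrable f -> square_integrable f' ->
  {ae mu, forall x, f x = f' x} -> weak_derive f = weak_derive f'.
Proof.
move=> sf sf' ff'; congr (xget _ _); apply/seteqP.
split=> g /= fg; have [sg _] := fg.
  by apply: is_weak_derive_ae fg => //; exact: aeW.
apply: is_weak_derive_ae fg => //; last exact: aeW.
by apply: ae_imply ff' => x ->.
Qed.

Lemma weak_derive_is_weak_derive f g : is_weak_derive f g ->
  is_weak_derive f (weak_derive f).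
Proof. by move=> fg; apply: (xgetPex (cst 0 : R -> R)); exists g. Qed.

Lemma weak_sobolev_square_integrable k f :
  weak_sobolev k f -> square_integrable f.
Proof. by case: k => [[]|k []]. Qed.

Lemma weak_sobolev_ae k f f' : square_integrable f' ->
  {ae mu, forall x, f x = f' x} -> weak_sobolev k f -> weak_sobolev k f'.
Proof.
move=> sf' ff'; case: k => [|k] [sf]; first by [].
move=> [g [fg sg]]; split=> //; exists g; split=> //.
by have [? _] := fg; apply: is_weak_derive_ae fg => //; exact: aeW.
Qed.

Lemma is_weak_derive_lin f f' g g' (a b : R) :
  square_integrable f -> square_integrable f' ->
  is_weak_derive f g -> is_weak_derive f' g' ->
  is_weak_derive (fun x => a * f x + b * f' x) (fun x => a * g x + b * g' x).
Proof.
move=> sf sf' [sg fg] [sg' fg']; split; first exact: square_integrable_lin.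
move=> phi tphi; have [sp sp'] := test_function_square_integrable tphi.
have lin h h' p : square_integrable h -> square_integrable h' -> square_integrable p ->
    \int[mu]_x ((a * h x + b * h' x) * p x) =
    a * \int[mu]_x (h x * p x) + b * \int[mu]_x (h' x * p x).
  move=> sh sh' sp0.
  have i1 := square_integrable_mul sh sp0; have i2 := square_integrable_mul sh' sp0.
  rewrite -RintegralZl// -[X in _ + X]RintegralZl// -RintegralD//.
  - by apply: eq_Rintegral => x _; ring.
  - exact: integrableZl_EFin.
  - exact: integrableZl_EFin.
by rewrite lin// lin// fg// fg'//; ring.
Qed.

Lemma weak_sobolev_lin k f f' (a b : R) : weak_sobolev k f -> weak_sobolev k f' ->
  weak_sobolev k (fun x => a * f x + b * f' x).
Proof.
elim: k f f' => [|k IH] f f' [sf +] [sf' +].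
  by move=> _ _; split=> //; exact: square_integrable_lin.
move=> [g [fg kg]] [g' [fg' kg']]; split; first exact: square_integrable_lin.
exists (fun x => a * g x + b * g' x); split; first exact: is_weak_derive_lin.
exact: IH.
Qed.

Lemma sobolev_lin k f f' (a b : R) : sobolev k f -> sobolev k f' ->
  sobolev k (fun x => a * f x + b * f' x).
Proof.
move=> [kf cf] [kf' cf']; split; first exact: weak_sobolev_lin.
move=> x; apply: cvgD; apply: cvgM; try exact: cvg_cst; [exact: cf|exact: cf'].
Qed.

End weak_derivative.

(** * Sobolev embedding *)

Section sobolev_embedding.
Context {R : realType}.
Implicit Types (f g h : R -> R).
Local Notation mu := (@lebesgue_measure R).

Lemma cvge0_near_le (T : Type) (F : set_system T) {FF : Filter F}
    (f : T -> \bar R) (d : R) : f x @[x --> F] --> 0%E -> 0 < d ->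
  \forall x \near F, (f x <= d%:E)%E.
Proof.
move=> /fine_cvgP[ffin /cvgr_lt/(_ d) f0] /f0 fd.
by apply: filterS2 ffin fd => x fx; rewrite -[f x]fineK// lee_fin => /ltW.
Qed.

Lemma integral_unit_itv (c x : R) : \int[mu]_(t in `[x, x + 1]) c = c.
Proof.
rewrite Rintegral_cst//= lebesgue_measure_itv/= lte_fin ltrDl ltr01 -EFinD/=.
by rewrite addrAC subrr add0r mulr1.
Qed.

Lemma square_integrable_sqr_itv h : square_integrable h ->
  itv_integrable (fun x => h x ^+ 2).
Proof.
move=> /square_integrableP[_ ih] x y.
by apply: integrableS ih.
Qed.

Lemma itv_integrable_cst (c : R) : itv_integrable (cst c).
Proof.
move=> x y; apply: continuous_compact_integrable; first exact: segment_compact.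
by apply: continuous_subspaceT => ?; exact: cvg_cst.
Qed.

(** Young's inequality [|h| <= e / 2 + h^2 / (2 e)], that is [(|h| - e)^2 >= 0], integrated over an
    interval of length 1. *)
Lemma integral_norm_le_sqr h (e x : R) : square_integrable h -> 0 < e ->
  \int[mu]_(t in `[x, x + 1]) `|h t| <=
  e / 2 + (2 * e)^-1 * \int[mu]_(t in `[x, x + 1]) h t ^+ 2.
Proof.
move=> sh e0; have sh2 := square_integrable_sqr_itv sh.
have i2 : mu.-integrable `[x, x + 1] (EFin \o (fun t => (2 * e)^-1 * h t ^+ 2)).
  by apply: integrableZl_EFin => //; exact: sh2.
rewrite -[e / 2](integral_unit_itv _ x) -RintegralZl//.
rewrite -RintegralD//; last exact: itv_integrable_cst.
apply: le_Rintegral => //.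
- by apply: itv_integrable_norm; exact: square_integrable_itv.
- by apply: integrableD_EFin => //; exact: itv_integrable_cst.
move=> t _; rewrite -[h t ^+ 2]real_normK ?num_real//.
have := sqr_ge0 (`|h t| - e); move: `|h t| => z hz.
rewrite -subr_ge0 [leRHS](_ : _ = (2 * e)^-1 * (z - e) ^+ 2).
  by rewrite mulr_ge0// invr_ge0 mulr_ge0// ltW.
by field; rewrite gt_eqF.
Qed.

(** [|f x|] is at most the mean of [|f|] over [[x, x + 1]] plus the integral of [|g|] there, and
    each is bounded by Young's inequality. The parameter [e] stays free: taken of the size of the L2
    norms, it gives a bound linear in them. The local integrals serve for decay as well as for sup
    norms. *)
Lemma sobolev_embedding f g (e x : R) : square_integrable f -> square_integrable g ->
  (forall x y, x <= y -> f y - f x = \int[mu]_(t in `[x, y]) g t) -> 0 < e ->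
  `|f x| <= e + (2 * e)^-1 * (\int[mu]_(t in `[x, x + 1]) f t ^+ 2 +
                              \int[mu]_(t in `[x, x + 1]) g t ^+ 2).
Proof.
move=> sf sg fg e0.
have lf := itv_integrable_norm (square_integrable_itv sf).
have lg := itv_integrable_norm (square_integrable_itv sg).
pose A := \int[mu]_(t in `[x, x + 1]) `|g t|.
have fA : `|f x| <= \int[mu]_(t in `[x, x + 1]) `|f t| + A.
  rewrite -[leLHS](integral_unit_itv _ x) -[A](integral_unit_itv _ x).
  rewrite -RintegralD//; last exact: itv_integrable_cst.
  apply: le_Rintegral => //; first exact: itv_integrable_cst.
    by apply: integrableD_EFin => //; exact: itv_integrable_cst.
  move=> y /=; rewrite in_itv/= => /andP[xy yx].
  rewrite -lerBlDl; apply: le_trans (lerB_dist _ _) _; rewrite distrC fg//.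
  apply: le_trans (le_normr_Rintegral _ _) _ => //; first exact: square_integrable_itv.
  rewrite -subr_ge0 /A itv_integral_sub//.
  exact: Rintegral_ge0.
apply: le_trans fA _.
have h1 := integral_norm_le_sqr x sf e0; have h2 := integral_norm_le_sqr x sg e0.
apply: le_trans (lerD h1 h2) _; rewrite mulrDr.
by rewrite addrACA -splitr.
Qed.

Lemma integral_itv_le f (x y : R) : square_integrable f ->
  ((\int[mu]_(t in `[x, y]) f t ^+ 2)%:E <= \int[mu]_t (f t ^+ 2)%:E)%E.
Proof.
move=> sf; rewrite /Rintegral fineK.
  apply: ge0_subset_integral => //.
  - apply/measurable_EFinP; apply: measurable_funX.
    exact: square_integrable_measurable.
  - by move=> t _; rewrite lee_fin sqr_ge0.
by apply: integrable_fin_num => //; exact: square_integrable_sqr_itv.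
Qed.

(** The integral of [f ^+ 2] over [|t| >= n] tends to 0 by dominated convergence. *)
Lemma square_integrable_tail f (d : R) : square_integrable f -> 0 < d ->
  exists2 M : R, 0 < M & forall x, M <= `|x| ->
    \int[mu]_(t in `[x, x + 1]) f t ^+ 2 <= d.
Proof.
move=> sf d0; have /square_integrableP[mf if2] := sf.
pose D n : set R := [set t | n%:R <= `|t|].
have mD n : measurable (D n).
  have -> : D n = Num.norm @^-1` `[n%:R, +oo[.
    by apply/seteqP; split=> t; rewrite /D /= in_itv/= andbT.
  by rewrite -[X in measurable X]setTI; exact: normr_measurable.
have mf2 : measurable_fun setT (fun t => (f t ^+ 2)%:E).
  by apply/measurable_EFinP; exact: measurable_funX.
have [] := @dominated_convergence _ _ _ mu setT measurableT
  (fun n => (fun t => (f t ^+ 2)%:E) \_ (D n)) (cst 0%E) (fun t => (f t ^+ 2)%:E).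
- move=> n; have [h _] := measurable_restrictT (fun t => (f t ^+ 2)%:E) (mD n).
  by apply: h; exact: measurable_funS mf2.
- exact: measurable_cst.
- apply: aeW => t _; apply: cvg_near_cst.
  near=> n; rewrite patchE memNset//= /D/=; apply/negP; rewrite -ltNge.
  near: n; exact: nbhs_infty_gtr.
- by [].
- apply: aeW => t n _; rewrite patchE; case: ifPn => _.
    by rewrite gee0_abs// lee_fin sqr_ge0.
  by rewrite abse0 lee_fin sqr_ge0.
move=> _ _; rewrite integral0 => h.
have [n hn] : exists n, (\int[mu]_t (((fun t => (f t ^+ 2)%:E) \_ (D n)) t) <= d%:E)%E.
  have [n _ hn] := cvge0_near_le h d0.
  by exists n; exact: (hn n (leqnn n)).
(* One more than [n], because points of [[x, x + 1]] may be closer to the origin than [x] by 1. *)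
exists (n%:R + 1); first by rewrite ltr_wpDl.
move=> x nx; rewrite -lee_fin; apply: le_trans hn.
rewrite -integral_mkcond /Rintegral fineK; last first.
  by apply: integrable_fin_num => //; exact: square_integrable_sqr_itv.
apply: ge0_subset_integral => //.
- exact: mD.
- exact: measurable_funS mf2.
- by move=> t _; rewrite lee_fin sqr_ge0.
move=> t /=; rewrite in_itv/= /D/= => /andP[xt tx].
have := lerB_dist x t; have : `|x - t| <= 1 by rewrite ler_norml; lra.
by lra.
Unshelve. all: by end_near. Qed.

(** With at least two weak derivatives, the first one [g] has a continuous representative [G]; [f],
    being a primitive of [G], is then classically differentiable with derivative [G]. The last
    conclusion links the chosen [weak_derive] to the classical one. *)
Lemma sobolev_derive k f : sobolev k.+2 f ->
  [/\ (forall x, derivable f x 1), sobolev k.+1 (derive1 f) &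
      {ae mu, forall x, weak_derive f x = derive1 f x}].
Proof.
move=> [[sf [g [fg kg]]] cf].
have [F [cF fF Fg]] := continuous_rep sf fg.
have fE := continuous_ae_eq cf cF fF.
have {}kg : weak_sobolev k.+1 g by [].
have sg := weak_sobolev_square_integrable kg.
have [_ [h [gh _]]] := kg.
have [G [cG gG _]] := continuous_rep sg gh.
have sG : square_integrable G by apply: square_integrable_ae gG => //; exact: continuous_measurable.
have lG := square_integrable_itv sG.
have fG x y : x <= y -> f y - f x = \int[mu]_(t in `[x, y]) G t.
  move=> xy; rewrite fE Fg//; apply: Rintegral_ae => //.
  - by apply: measurable_funTS; exact: square_integrable_measurable.
  - by apply: measurable_funTS; exact: square_integrable_measurable.
have df (x : R) : is_derive x 1 f (G x).
  have x1 : x < x + 1 by rewrite ltrDl.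
  have Ax : x - 1 < x by rewrite ltrBlDr ltrDl.
  have [h1 h2] := continuous_FTC1_closed x1 (lG (x - 1) (x + 1)) Ax (cG x).
  have hI : is_derive x 1 (fun y : R => \int[mu]_(t in `[x - 1, y]) G t) (G x).
    by split; [exact: h1|rewrite -derive1E; exact: h2].
  apply: (@near_eq_is_derive _ _ _ (fun y : R => f (x - 1) + \int[mu]_(t in `[x - 1, y]) G t)).
    near=> y; rewrite -fG; first by rewrite addrC subrK.
    by apply: ltW; near: y; exact: lt_nbhsr.
  apply: (is_derive_eq (is_deriveD (is_derive_cst _ _ _) hI)).
  by rewrite add0r.
have dfE : derive1 f = G by apply/funext => x; rewrite derive1E derive_val.
split; first by move=> x; case: (df x).
  by rewrite dfE; split=> //; apply: weak_sobolev_ae kg.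
rewrite dfE; apply: ae_imply2 (weak_derive_unique sf (weak_derive_is_weak_derive fg) fg) gG.
by move=> x -> ->.
Unshelve. all: by end_near. Qed.

End sobolev_embedding.

(** * Sup norms and decay from Sobolev norms *)

Section sobolev_norm.
Context {R : realType}.
Implicit Types (f g h : R -> R) (e : R).
Local Notation mu := (@lebesgue_measure R).
Local Notation N2 f := ('N[mu]_2%:E[EFin \o f]%E).

Lemma Lnorm2_le_sobolev_norm k f j : (j <= k)%N ->
  (N2 (iter j (@weak_derive R) f) <= sobolev_norm k f)%E.
Proof.
move=> jk; rewrite /sobolev_norm (bigD1 (Ordinal (jk : (j < k.+1)%N)))//=.
set N := N2 _; set S := (\sum_(_ < _ | _) _)%E.
have N0 : (0 <= N)%E by exact: Lnorm_ge0.
have S0 : (0 <= S)%E.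
  by apply: sume_ge0 => i _; rewrite mule_ge0// Lnorm_ge0.
have NE : N = ((N * N) `^ (2^-1))%E.
  move: N N0 {S S0} => [r r0|_|//]; last by rewrite mulyy poweRyr.
  by rewrite -EFinM poweR_EFin -expr2 -powR_mulrn// -powRrM mulfV// powRr1.
rewrite [leLHS]NE; apply: gt0_ler_poweR; rewrite ?in_itv/= ?leey ?andbT//.
- by rewrite mule_ge0.
- by rewrite adde_ge0// mule_ge0.
- by rewrite leeDl.
Qed.

Lemma Lnorm2_le_integral f e : 0 <= e -> (N2 f <= e%:E)%E ->
  (\int[mu]_x (f x ^+ 2)%:E <= (e ^+ 2)%:E)%E.
Proof.
move=> e0 fe; rewrite -Lnorm2_poweR.
have -> : ((e ^+ 2)%:E = e%:E `^ 2)%E by rewrite /= powR_mulrn.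
by apply: gt0_ler_poweR; rewrite ?in_itv/= ?leey ?andbT ?Lnorm_ge0.
Qed.

(** Shifts the index in the terms of the Sobolev norm, for inductions that replace [f] by its
    derivative. For [j = 0] the two functions agree only almost everywhere; from [j = 1] on they are
    equal by [weak_derive_ae]. *)
Lemma Lnorm2_iter_weak_derive k f j : sobolev k.+2 f ->
  N2 (iter j (@weak_derive R) (derive1 f)) = N2 (iter j.+1 (@weak_derive R) f).
Proof.
move=> kf; have [df [kf' _] wf] := sobolev_derive kf.
have sf' := weak_sobolev_square_integrable kf'.
have swf : square_integrable (weak_derive f).
  have [[_ [g [/weak_derive_is_weak_derive[sg _] _]]] _] := kf.
  exact: sg.
case: j => [|j].
  apply: Lnorm2_ae; [exact: square_integrable_measurable..|].
  by apply: ae_imply wf => x /= ->.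
by rewrite !iterSr (weak_derive_ae swf sf' wf).
Qed.

Lemma sobolev_derive1n j k f : sobolev (j + k).+1 f -> sobolev k.+1 (derive1n j f).
Proof.
elim: j f => [|j IH] f //; rewrite addSn => jkf.
by rewrite derive1Sn; apply: IH; case: (sobolev_derive jkf).
Qed.

Lemma sobolev_derivable j k f : (j < k)%N -> sobolev k.+1 f ->
  forall x, derivable (derive1n j f) x 1.
Proof.
move=> jk kf; have : sobolev (k - j).+1 (derive1n j f).
  by apply: sobolev_derive1n; rewrite subnKC// ltnW.
by move: jk; rewrite -subn_gt0; case: (k - j)%N => // n _ /sobolev_derive[].
Qed.

Lemma sobolev_continuous j k f : (j <= k)%N -> sobolev k.+1 f ->
  continuous (derive1n j f).
Proof.
move=> jk kf; have [//] : sobolev (k - j).+1 (derive1n j f).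
by apply: sobolev_derive1n; rewrite subnKC.
Qed.

Lemma derive1n_lin k f g (a b : R) j : (j <= k)%N -> sobolev k.+1 f -> sobolev k.+1 g ->
  derive1n j (fun x => a * f x + b * g x) =
  (fun x => a * derive1n j f x + b * derive1n j g x).
Proof.
move=> + kf kg; elim: j => // j IH jk.
rewrite derive1nS IH; last exact: ltnW.
have df := sobolev_derivable jk kf; have dg := sobolev_derivable jk kg.
apply/funext => x; rewrite !derive1nS.
have [_ E] := is_deriveD (is_deriveM (is_derive_cst a x 1) (derivableP (df x)))
  (is_deriveM (is_derive_cst b x 1) (derivableP (dg x))).
by rewrite derive1E; apply: (etrans E); rewrite !scaler0 !addr0 !derive1E.
Qed.

(** This also covers H^1, where no classical derivative need exist, and it uses the very weak
    derivative that enters the norm. *)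
Lemma sobolev_increment k f : sobolev k.+1 f ->
  square_integrable f /\ square_integrable (weak_derive f) /\
  forall x y, x <= y -> f y - f x = \int[mu]_(t in `[x, y]) weak_derive f t.
Proof.
move=> [[sf [g [/weak_derive_is_weak_derive fg _]]] cf].
have [F [cF fF Fg]] := continuous_rep sf fg.
have FE := continuous_ae_eq cf cF fF; have [sg _] := fg.
by split; [exact: sf|split; [exact: sg|]] => x y xy; rewrite -Fg// -FE.
Qed.

(** The embedding with parameter [e] gives [e + (e^2 + e^2) / (2 e) = 2 e]. Assuming bounds on just
    two terms of the norm lets the induction on [j] shift them. *)
Lemma sobolev_bound_Lnorm2 j k f e : 0 < e -> (j <= k)%N -> sobolev k.+1 f ->
  (N2 (iter j (@weak_derive R) f) <= e%:E)%E ->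
  (N2 (iter j.+1 (@weak_derive R) f) <= e%:E)%E ->
  forall x, `|derive1n j f x| <= 2 * e.
Proof.
move=> e0; elim: j k f => [|j IH] k f.
  move=> _ kf f0 f1 x; have [sf [sg fg]] := sobolev_increment kf.
  have h1 := le_trans (integral_itv_le x (x + 1) sf) (Lnorm2_le_integral (ltW e0) f0).
  have h2 := le_trans (integral_itv_le x (x + 1) sg) (Lnorm2_le_integral (ltW e0) f1).
  rewrite !lee_fin in h1 h2.
  apply: le_trans (sobolev_embedding x sf sg fg e0) _.
  rewrite [leRHS](_ : _ = e + (2 * e)^-1 * (e ^+ 2 + e ^+ 2)); last by field; rewrite gt_eqF.
  by rewrite lerD2l ler_wpM2l ?invr_ge0 ?mulr_ge0 ?(ltW e0)// lerD.
case: k => // k; rewrite ltnS => jk kf.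
rewrite derive1Sn -(Lnorm2_iter_weak_derive j kf) -(Lnorm2_iter_weak_derive j.+1 kf).
by apply: IH jk _; case: (sobolev_derive kf).
Qed.

Lemma sobolev_bound j k f e : 0 < e -> (j <= k)%N -> sobolev k.+1 f ->
  (sobolev_norm k.+1 f <= e%:E)%E -> forall x, `|derive1n j f x| <= 2 * e.
Proof.
move=> e0 jk kf fe; apply: (sobolev_bound_Lnorm2 e0 jk kf).
  by apply: le_trans fe; apply: Lnorm2_le_sobolev_norm; rewrite leqW.
by apply: le_trans fe; exact: Lnorm2_le_sobolev_norm.
Qed.

(** The same computation with [e / 2], applied to tails of size at most [(e / 2) ^+ 2]. *)
Lemma sobolev_decay j k f e : (j <= k)%N -> sobolev k.+1 f -> 0 < e ->
  exists2 M, 0 < M & forall x, M <= `|x| -> `|derive1n j f x| <= e.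
Proof.
move=> jk kf e0.
have {kf jk} kf : sobolev (k - j).+1 (derive1n j f).
  by apply: sobolev_derive1n; rewrite subnKC.
have [sf [sg fg]] := sobolev_increment kf.
have d0 : 0 < (e / 2) ^+ 2 by rewrite exprn_gt0// divr_gt0.
have [M M0 hM] := square_integrable_tail sf d0.
have [M' M0' hM'] := square_integrable_tail sg d0.
exists (M + M'); first by rewrite addr_gt0.
move=> x xM; have e20 : 0 < e / 2 by rewrite divr_gt0.
apply: le_trans (sobolev_embedding x sf sg fg e20) _.
rewrite [leRHS](_ : _ = e / 2 + (2 * (e / 2))^-1 * ((e / 2) ^+ 2 + (e / 2) ^+ 2));
  last by field; rewrite gt_eqF.
rewrite lerD2l; apply: ler_wpM2l; first by rewrite invr_ge0 mulr_ge0 // ltW.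
apply: lerD; [apply: hM|apply: hM']; apply: le_trans xM.
  by rewrite lerDl ltW.
by rewrite lerDr ltW.
Qed.

End sobolev_norm.

(** * Finite speed of propagation *)

Section finite_propagation.
Context {R : realType}.
Implicit Types (f : R -> R) (m a b : R -> R -> R) (e : R).

Definition vanishes_at_infinity f :=
  forall e, 0 < e -> exists2 M, 0 < M & forall x, M <= `|x| -> `|f x| <= e.

(** If [f] is positive somewhere, decay confines the search for a maximum to a segment. Otherwise
    [f <= 0] and [c], where [f] is nonnegative, is a maximum. *)
Lemma vanishing_max f (c : R) : continuous f -> vanishes_at_infinity f -> 0 <= f c ->
  exists x0, forall x, f x <= f x0.
Proof.
move=> cf f0 fc.
have [[x1 fx1]|fle0] := pselect (exists x1, 0 < f x1); last first.
  exists c => x; apply: le_trans fc; rewrite leNgt; apply/negP => fx.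
  by apply: fle0; exists x.
have fx12 : 0 < f x1 / 2 by rewrite divr_gt0.
have [M M0 hM] := f0 _ fx12.
have MM : - M <= M by rewrite (le_trans _ (ltW M0))// oppr_le0 ltW.
have [x0 _ hx0] := EVT_max MM (continuous_subspaceT cf).
have x1M : `|x1| < M.
  rewrite ltNge; apply/negP => /hM /(le_trans (ler_norm _)) h; move: fx1 h; lra.
have x10 : f x1 <= f x0 by apply: hx0; rewrite in_itv/= -ler_norml ltW.
exists x0 => x; have [xM|Mx] := leP `|x| M.
  by apply: hx0; rewrite in_itv/= -ler_norml.
apply: (le_trans (ler_norm _)); apply: (le_trans (hM _ (ltW Mx))).
by apply: le_trans x10; rewrite ler_pdivrMr// ler_peMr ?ler1n// ltW.
Qed.

Lemma vanishing_bounded f : continuous f -> vanishes_at_infinity f ->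
  exists2 B, 0 <= B & forall x, `|f x| <= B.
Proof.
move=> cf f0; have [M M0 hM] := f0 1 ltr01.
have MM : - M <= M by rewrite (le_trans _ (ltW M0))// oppr_le0 ltW.
have cn : continuous (fun x => `|f x|) by move=> x; apply: cvg_norm; exact: cf.
have [x0 _ hx0] := EVT_max MM (continuous_subspaceT cn).
exists (`|f x0| + 1) => [|x]; first by rewrite addr_ge0.
have [xM|Mx] := leP `|x| M.
  by apply: (le_trans (hx0 x _)); rewrite ?lerDl// in_itv/= -ler_norml.
by apply: (le_trans (hM _ (ltW Mx))); rewrite lerDr.
Qed.

(** Left difference quotients only, since the maximum over time may be reached at the final time. *)
Lemma derive1_ge0_at_right_max f (s : R) : 0 < s -> derivable f s 1 ->
  (forall r, 0 <= r <= s -> f r <= f s) -> 0 <= derive1 f s.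
Proof.
move=> s0 df fmax.
have h : h^-1 *: (f (h + s) - f s) @[h --> 0^'-] --> derive1 f s.
  apply: cvg_dnbhs_at_left; rewrite derive1E /derive.
  have -> : (fun h : R => h^-1 *: (f (h + s) - f s)) =
            (fun h : R => h^-1 *: ((f \o shift s) (h *: 1) - f s)).
    by apply/funext => h /=; rewrite /GRing.scale/= mulr1.
  exact: df.
apply: (ler_cvg_to (cvg_cst (0 : R)) h); near=> r => /=.
have r0 : r < 0 by near: r; exact: nbhs_left_lt.
have rs : - s <= r by near: r; apply: nbhs_left_ge; rewrite oppr_lt0.
apply: mulr_le0; first by rewrite invr_le0 ltW.
rewrite subr_le0; apply: fmax; apply/andP; split.
  by rewrite -lerBlDr sub0r.
by rewrite gerDr ltW.
Unshelve. all: by end_near. Qed.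

(** A rational formula reduces its bounds, its Lipschitz constant 1 and its derivative to algebra.
    The derivative is only taken at positive arguments. *)
Definition cutoff (y : R) : R := if 0 < y then y ^+ 2 / (1 + y ^+ 2) else 0.

Lemma cutoff_itv y : 0 <= cutoff y <= 1.
Proof.
rewrite /cutoff; case: ifPn => [y0|_]; last by rewrite lexx ler01.
have y2 : 0 < y ^+ 2 by rewrite exprn_gt0.
have y21 : 0 < 1 + y ^+ 2 by rewrite addr_gt0.
apply/andP; split; first by rewrite divr_ge0// ltW.
by rewrite ler_pdivrMr// mul1r lerDr.
Qed.

Lemma cutoff_gt0 y : (0 < cutoff y) = (0 < y).
Proof.
rewrite /cutoff; case: ifPn => [y0|_]; last by rewrite ltxx.
by rewrite divr_gt0 ?addr_gt0 ?exprn_gt0.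
Qed.

Lemma cutoff_lipschitz y z : `|cutoff y - cutoff z| <= `|y - z|.
Proof.
wlog yz : y z / z <= y.
  by move=> H; have [/H//|/ltW /H] := leP z y; rewrite distrC [leRHS]distrC.
rewrite [leRHS]ger0_norm ?subr_ge0// /cutoff.
case: (ltP 0 y) => y0; last first.
  by rewrite ltNge (le_trans yz y0)/= subrr normr0 subr_ge0.
have y2 : 0 < 1 + y ^+ 2 by rewrite addr_gt0 ?exprn_gt0.
case: (ltP 0 z) => z0.
  have z2 : 0 < 1 + z ^+ 2 by rewrite addr_gt0 ?exprn_gt0.
  have -> : y ^+ 2 / (1 + y ^+ 2) - z ^+ 2 / (1 + z ^+ 2) =
    (y - z) * ((y + z) / ((1 + y ^+ 2) * (1 + z ^+ 2))).
    by field; rewrite !gt_eqF.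
  have yz0 : 0 < y + z by rewrite addr_gt0.
  rewrite normrM ger0_norm ?subr_ge0// ler_piMr ?subr_ge0//.
  have yz2 := mulr_gt0 y2 z2.
  rewrite ger0_norm; last by rewrite divr_ge0 // ltW.
  rewrite ler_pdivrMr// mul1r.
  have := sqr_ge0 (y - 1); have := sqr_ge0 (z - 1); have := sqr_ge0 (y * z).
  by rewrite !sqrrB !mulr1 !expr1n => *; nra.
rewrite subr0 ger0_norm; last by rewrite divr_ge0 ?sqr_ge0 // ltW.
rewrite ler_pdivrMr//; have := sqr_ge0 (y - 1); rewrite sqrrB !mulr1 expr1n => h.
nra.
Qed.

Lemma is_derive_cutoff (y : R) : 0 < y ->
  is_derive y 1 cutoff (2 * y / (1 + y ^+ 2) ^+ 2).
Proof.
move=> y0.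
have y2 : 1 + y ^+ 2 != 0 by rewrite gt_eqF// addr_gt0 ?exprn_gt0.
apply: (@near_eq_is_derive _ _ _ (fun y : R => y ^+ 2 * (1 + y ^+ 2)^-1)).
  near=> z; rewrite /cutoff ifT//; near: z; exact: lt_nbhsr.
have d2 : is_derive y 1 (fun z : R => z ^+ 2) (2 * y).
  apply: (is_derive_eq (is_deriveM (is_derive_id y 1) (is_derive_id y 1))).
  by rewrite /GRing.scale/= !mulr1; ring.
have d3 : is_derive y 1 (fun z : R => (1 + z ^+ 2)^-1) (- (1 + y ^+ 2) ^- 2 *: (2 * y)).
  apply: is_deriveV => //; have := is_deriveD (is_derive_cst (1 : R) y 1) d2.
  by rewrite add0r.
apply: (is_derive_eq (is_deriveM d2 d3)).
by rewrite /GRing.scale/=; field.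
Unshelve. all: by end_near. Qed.


Lemma continuous_cutoff : continuous cutoff.
Proof.
move=> y; apply/cvgrPdist_le => e e0; near=> z.
apply: le_trans (cutoff_lipschitz _ _) _; near: z.
by have := @cvg_id _ (nbhs y) => /cvgrPdist_le/(_ e e0).
Unshelve. all: by end_near. Qed.

(** A supremum moves no more than the functions do in sup norm. The selection [X] of maximum points
    may well be discontinuous; only the maximal value is continuous. *)
Lemma within_continuous_sup (n : R -> R -> R) (X : R -> R) (t0 : R) :
  (forall s, s \in `[0, t0] -> forall x, n s x <= n s (X s)) ->
  (forall s, s \in `[0, t0] -> forall e, 0 < e ->
    \forall r \near s, r \in `[0, t0] -> forall x, `|n r x - n s x| <= e) ->
  {within `[0, t0], continuous (fun s => n s (X s))}.
Proof.
move=> hX nt; apply/subspace_continuousP => s si; apply/cvgrPdist_le => e e0.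
rewrite near_withinE; apply: filterS (nt s si e e0) => r nn ri.
change (`|n s (X s) - n r (X r)| <= e).
have := nn ri (X s); have := nn ri (X r); rewrite !ler_norml.
have := hX s si (X r); have := hX r ri (X s).
move: (n s (X s)) (n s (X r)) (n r (X s)) (n r (X r)) => p p' q q'.
by move=> h3 h4 /andP[h5 h6] /andP[h7 h8]; apply/andP; split; lra.
Qed.

(** The equation [m_t + a m_x + b m = 0] is required at positive times only, with mere continuity at
    time 0. In [transport_near] the estimate is uniform in [x], as the continuity of the spatial
    supremum demands. *)
Record transport m a b (t0 K B : R) : Prop := Transport {
  transport_gt0 : 0 < t0;
  transport_continuous : forall s, s \in `[0, t0] -> continuous (m s);
  transport_vanishes : forall s, s \in `[0, t0] -> vanishes_at_infinity (m s);
  transport_near : forall s, s \in `[0, t0] -> forall e, 0 < e ->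
    \forall r \near s, r \in `[0, t0] -> forall x, `|m r x - m s x| <= e;
  transport_equation : forall s x, 0 < s <= t0 -> [/\ derivable (m s) x 1,
    derivable (m^~ x) s 1 &
    derive1 (m^~ x) s + a s x * derive1 (m s) x + b s x * m s x = 0];
  transport_speed : forall s x, s \in `[0, t0] -> `|a s x| <= K;
  transport_potential : forall s x, s \in `[0, t0] -> `|b s x| <= B }.

Lemma transport_le0 m a b (t0 K B c : R) : transport m a b t0 K B ->
  (forall x, c < x -> m 0 x = 0) ->
  forall s x, s \in `[0, t0] -> c + K * s < x -> m s x <= 0.
Proof.
move=> [t00 cm m0 mt dm aK bB] mc.
have zin : (0 : R) \in `[0, t0] by rewrite in_itv/= lexx ltW.
have K0 : 0 <= K by apply: le_trans (aK 0 0 zin).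
pose z (s x : R) := x - c - K * s.
pose n s x := m s x * cutoff (z s x).
have cut1 y : `|cutoff y| <= 1 by have /andP[? ?] := cutoff_itv y; rewrite ger0_norm.
have nmax s : exists x0, s \in `[0, t0] -> forall x, n s x <= n s x0.
  have [si|si] := boolP (s \in `[0, t0]); last by exists 0.
  (* At [c] the cutoff has argument [- K * s <= 0], so [n s c = 0]: this is the nonnegative value
     that [vanishing_max] asks for. *)
  have [|||x0 hx0] := @vanishing_max (n s) c.
  - move=> x; apply: cvgM; first exact: cm.
    have cz : z s y @[y --> x] --> z s x.
      by apply: cvgB; [apply: cvgB; [exact: cvg_id|exact: cvg_cst]|exact: cvg_cst].
    exact: (cvg_comp (z s) cutoff cz (@continuous_cutoff (z s x))).
  - move=> e e0; have [M M0 hM] := m0 s si e e0; exists M => // x /hM; apply: le_trans.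
    by rewrite normrM ler_piMr.
  - rewrite /n /cutoff ifF ?mulr0//; apply/negbTE; rewrite -leNgt /z subrr sub0r oppr_le0.
    by move: si; rewrite in_itv/= => /andP[s0 _]; rewrite mulr_ge0.
  by exists x0.
have [X hX] := choice nmax.
pose F s := n s (X s).
have cF : {within `[0, t0], continuous F}.
  apply: within_continuous_sup => [s si|s si e e0]; first exact: hX.
  have [Bd Bd0 hBd] := vanishing_bounded (cm s si) (m0 s si).
  have e20 : 0 < e / 2 by rewrite divr_gt0.
  (* The variation of [n] comes from that of [m] and from the motion of the cutoff at speed [K];
     half of [e] is given to each. The [+ 1] keeps the denominator positive. *)
  have BK : 0 < Bd * K + 1 by rewrite ltr_wpDl ?mulr_ge0.
  have ed : 0 < e / 2 / (Bd * K + 1) by rewrite divr_gt0.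
  have nr1 := mt s si _ e20.
  have nr2 : \forall r \near s, `|s - r| <= e / 2 / (Bd * K + 1).
    by have := @cvg_id _ (nbhs s) => /cvgrPdist_le/(_ _ ed).
  apply: filterS2 nr1 nr2 => r h1 h2 ri x.
  have -> : n r x - n s x = (m r x - m s x) * cutoff (z r x) +
      m s x * (cutoff (z r x) - cutoff (z s x)) by rewrite /n; ring.
  apply: le_trans (ler_normD _ _) _; rewrite [leRHS]splitr lerD//.
    by rewrite normrM (le_trans _ (h1 ri x))// ler_piMr.
  rewrite normrM; apply: (@le_trans _ _ (Bd * (K * `|s - r|))).
    apply: ler_pM => //; apply: le_trans (cutoff_lipschitz _ _) _.
    have -> : z r x - z s x = K * (s - r) by rewrite /z; ring.
    by rewrite normrM (ger0_norm K0).
  rewrite mulrA; move: h2; rewrite ler_pdivlMr// mulrDr mulr1 mulrC.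
  by apply: le_trans; rewrite lerDl.
(* The first term of the derivative of [v] along the flow, in
   [(- C - b) n + m (a - K) cutoff'], is negative where [n] is positive; the second
   one is nonpositive since the cutoff moves at least as fast as the flow. *)
pose C := B + 1; pose v s x := expR (- C * s) * n s x.
have [s1 s1i hs1] : exists2 s1, s1 \in `[0, t0] &
    forall s, s \in `[0, t0] -> expR (- C * s) * F s <= expR (- C * s1) * F s1.
  apply: (@EVT_max _ (fun s => expR (- C * s) * F s)); first exact: ltW.
  move/subspace_continuousP : cF => cF.
  apply/subspace_continuousP => s si; apply: cvgM; last exact: cF.
  apply: cvg_within_filter; apply: (cvg_comp (fun s => - C * s) expR); last exact: continuous_expR.
  by apply: cvgM; [exact: cvg_cst|exact: cvg_id].
pose x1 := X s1.
have hv s x : s \in `[0, t0] -> v s x <= v s1 x1.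
  move=> si; apply: le_trans (hs1 s si); rewrite /v ler_pM2l ?expR_gt0//.
  exact: hX.
move=> s x si sx; rewrite leNgt; apply/negP => msx.
have v10 : 0 < v s1 x1.
  apply: lt_le_trans (hv s x si); rewrite /v !mulr_gt0 ?expR_gt0// cutoff_gt0 /z.
  by move: sx; lra.
have n10 : 0 < n s1 x1 by move: v10; rewrite /v pmulr_rgt0 ?expR_gt0.
have c10 : 0 < cutoff (z s1 x1).
  have /andP[c0 _] := cutoff_itv (z s1 x1).
  rewrite lt_neqAle c0 andbT; apply/eqP => c1.
  by move: n10; rewrite /n -c1 mulr0 ltxx.
have m10 : 0 < m s1 x1 by move: n10; rewrite /n pmulr_lgt0.
have z10 : 0 < z s1 x1 by rewrite -cutoff_gt0.
(* At time 0, a point with positive cutoff lies to the right of [c], where [m] vanishes. *)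
have s10 : 0 < s1.
  move: s1i; rewrite in_itv/= => /andP[]; rewrite le_eqVlt => /predU1P[s10|//] _.
  move: m10; rewrite -s10 mc ?ltxx//; move: z10; rewrite /z -s10 mulr0; lra.
have s1t : 0 < s1 <= t0 by move: s1i; rewrite in_itv/= s10 => /andP[].
have [dmx dms eq1] := dm s1 x1 s1t.
pose d := 2 * z s1 x1 / (1 + z s1 x1 ^+ 2) ^+ 2.
have d0 : 0 <= d.
  by rewrite /d divr_ge0 ?sqr_ge0// mulr_ge0 // ltW.
have dxE (y : R) : 0 < z s1 y -> is_derive y 1 (n s1)
    (m s1 y * (2 * z s1 y / (1 + z s1 y ^+ 2) ^+ 2) + cutoff (z s1 y) * derive1 (m s1) y).
  move=> zy.
  have dz : is_derive y 1 (z s1) 1.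
    have := is_deriveB (is_deriveB (is_derive_id y 1) (is_derive_cst c y 1))
      (is_derive_cst (K * s1) y 1).
    by rewrite !subr0.
  have dc := is_derive1_comp (is_derive_cutoff zy) dz.
  have [dmy _ _] := dm s1 y s1t.
  apply: (is_derive_eq (is_deriveM (derivableP dmy) dc)).
  by rewrite /GRing.scale/= mulr1 derive1E.
have dx0 : m s1 x1 * d + cutoff (z s1 x1) * derive1 (m s1) x1 = 0.
  have [_ <-] := dxE x1 z10.
  (* The left end [x1 - z s1 x1] is the front [c + K * s1], so the cutoff is differentiable on the
     whole open interval. *)
  have ltx : x1 - z s1 x1 < x1 + 1.
    by rewrite (@lt_trans _ _ x1)// ?ltrDl// ltrBlDr ltrDl.
  have [] := @derive1_at_max R (n s1) (x1 - z s1 x1) (x1 + 1) x1 (ltW ltx).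
  - move=> y; rewrite in_itv/= => /andP[y1 _].
    have zy : 0 < z s1 y by move: y1; rewrite /z; lra.
    by case: (dxE y zy).
  - by rewrite in_itv/= ltrDl ltr01 andbT ltrBlDr ltrDl.
  - by move=> y _; exact: hX.
  - by [].
have ds : is_derive s1 1 (fun s => v s x1)
    (expR (- C * s1) * (- C * n s1 x1 + (cutoff (z s1 x1) * derive1 (m^~ x1) s1 -
       m s1 x1 * (K * d)))).
  have dz : is_derive s1 1 (z^~ x1) (- K).
    have := is_deriveB (is_derive_cst (x1 - c) s1 1)
      (is_deriveM (is_derive_cst K s1 1) (is_derive_id s1 1)).
    by rewrite sub0r scaler0 addr0 /GRing.scale/= mulr1.
  have dc := @is_derive1_comp _ cutoff (z^~ x1) s1 _ _ (is_derive_cutoff z10) dz.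
  have dC : is_derive s1 1 (fun s : R => - C * s) (- C).
    have := is_deriveM (is_derive_cst (- C) s1 1) (is_derive_id s1 1).
    by rewrite scaler0 addr0 /GRing.scale/= mulr1.
  have dE := @is_derive1_comp _ expR (fun s : R => - C * s) s1 _ _ (is_derive_expR _) dC.
  apply: (is_derive_eq (is_deriveM dE (is_deriveM (derivableP dms) dc))).
  rewrite derive1E /n -/d.
  change (expR (- C * s1) * (m s1 x1 * (d * - K) +
      cutoff (z s1 x1) * 'D_1 (m^~ x1) s1) +
    m s1 x1 * cutoff (z s1 x1) * (expR (- C * s1) * - C) =
    expR (- C * s1) * (- C * (m s1 x1 * cutoff (z s1 x1)) +
      (cutoff (z s1 x1) * 'D_1 (m^~ x1) s1 - m s1 x1 * (K * d)))).
  by move: (expR _) (cutoff _) (derive _ _ _) => E' c' D'; ring.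
have := @derive1_ge0_at_right_max (fun s => v s x1) s1 s10.
rewrite derive1E derive_val pmulr_rge0 ?expR_gt0//.
have dv : derivable (v^~ x1) s1 1 by case: ds.
have vmax r : 0 <= r <= s1 -> v r x1 <= v s1 x1.
  move=> /andP[r0 rs]; apply: hv; rewrite in_itv/= r0 (le_trans rs)//.
  by case/andP: s1t.
move=> /(_ dv vmax).
have := aK s1 x1 s1i; have := bB s1 x1 s1i; rewrite !ler_norml => /andP[b1 b2] /andP[a1 a2].
apply/negP; rewrite -ltNge /n.
have -> : derive1 (m^~ x1) s1 = - a s1 x1 * derive1 (m s1) x1 - b s1 x1 * m s1 x1.
  by move: eq1; lra.
move: dx0 m10 c10 d0 b1 a2; rewrite /C.
move: (m s1 x1) (cutoff _) (derive1 _ _) (a _ _) (b _ _) => M c' mx a' b' h M0 c0 d0 b1 a2.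
(* The vanishing of the space derivative trades [c' * mx] for [- M * d], so the transport term joins
   the one due to the moving cutoff and leaves [- (K - a') * (M * d)]. *)
have -> : c' * (- a' * mx - b' * M) = a' * (M * d) - b' * M * c'.
  have -> : M * d = - (c' * mx) by move: h; lra.
  by ring.
have h1 : 0 <= (K - a') * (M * d).
  by apply: mulr_ge0; [rewrite subr_ge0|apply: mulr_ge0 => //; exact: ltW].
(* Since [b' >= - B], the first factor is at least 1: this is the role of the [+ 1] in [C], and it
   makes the contradiction strict. *)
have h2 : 0 < (B + 1 + b') * (M * c') by rewrite !mulr_gt0//; lra.
lra.
Unshelve. all: by end_near. Qed.


Lemma transportN m a b (t0 K B : R) : transport m a b t0 K B ->
  transport (fun s x => - m s x) a b t0 K B.
Proof.
move=> [t00 cm m0 mt dm aK bB]; split=> //.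
- by move=> s si x; apply: cvgN; exact: cm.
- move=> s si e e0; have [M M0 hM] := m0 s si e e0; exists M => // x.
  by rewrite normrN; exact: hM.
- move=> s si e e0; apply: filterS (mt s si e e0) => r h ri x.
  by rewrite -opprD normrN h.
- move=> s x si; have [d1 d2 eq1] := dm s x si; split.
  + exact: derivableN.
  + exact: derivableN.
  + have -> : derive1 (fun y => - m y x) s = - derive1 (m^~ x) s.
      by rewrite [LHS]derive1E [X in _ = - X]derive1E; exact: (deriveN d2).
    have -> : derive1 (fun y => - m s y) x = - derive1 (m s) x.
      by rewrite [LHS]derive1E [X in _ = - X]derive1E; exact: (deriveN d1).
    by rewrite !mulrN -!opprD eq1 oppr0.
Qed.

(** Reflection reverses the velocity and keeps the potential, so the bounds [K] and [B] are
    unchanged. *)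
Lemma transport_reflect m a b (t0 K B : R) : transport m a b t0 K B ->
  transport (fun s x => m s (- x)) (fun s x => - a s (- x)) (fun s x => b s (- x)) t0 K B.
Proof.
move=> [t00 cm m0 mt dm aK bB]; split=> //.
- move=> s si x; apply: (cvg_comp -%R (m s)); last exact: cm.
  exact: oppr_continuous.
- move=> s si e e0; have [M M0 hM] := m0 s si e e0; exists M => // x xM.
  by apply: hM; rewrite normrN.
- move=> s si e e0; apply: filterS (mt s si e e0) => r h ri x; exact: h.
- move=> s x si; have [d1 d2 eq1] := dm s (- x) si.
  have dN : is_derive x 1 (fun y : R => - y) (- 1) by exact: is_deriveN.
  have dmN := @is_derive1_comp _ (m s) (fun y : R => - y) x _ _ (derivableP d1) dN.
  split; [by case: dmN => h _; exact: h|exact: d2|].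
  have -> : derive1 (fun y => m s (- y)) x = - derive1 (m s) (- x).
    rewrite [LHS]derive1E [X in _ = - X]derive1E; have [_ E] := dmN.
    by rewrite [LHS]E mulrN1.
  by rewrite mulrNN.
- by move=> s x si; rewrite normrN aK.
- by move=> s x si; rewrite bB.
Qed.

Lemma transport_support m a b (t0 K B c : R) : transport m a b t0 K B ->
  (forall x, c < `|x| -> m 0 x = 0) ->
  forall s x, s \in `[0, t0] -> c + K * s < `|x| -> m s x = 0.
Proof.
move=> tm mc.
have right m' a' b' : transport m' a' b' t0 K B ->
    (forall x, c < x -> m' 0 x = 0) ->
    forall s x, s \in `[0, t0] -> c + K * s < x -> m' s x = 0.
  move=> tm' mc' s x si sx; apply/eqP; rewrite eq_le (transport_le0 tm' mc')//=.
  rewrite -oppr_le0; apply: (transport_le0 (transportN tm') _ si sx) => y /mc' ->.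
  by rewrite oppr0.
move=> s x si; have [x0|x0] := leP 0 x => sx.
  rewrite ger0_norm// in sx; apply: (right _ _ _ tm _ s x si sx) => y cy.
  by apply: mc; rewrite (lt_le_trans cy)// ler_norm.
rewrite ltr0_norm// in sx; rewrite -[x]opprK.
apply: (right _ _ _ (transport_reflect tm) _ s (- x) si sx) => y cy.
by apply: mc; rewrite normrN (lt_le_trans cy)// ler_norm.
Qed.

(** The spatial maximum of [|f s|] is continuous in [s] on a compact interval. This provides the
    speed and potential bounds. *)
Lemma uniformly_bounded (f : R -> R -> R) (t0 : R) : 0 <= t0 ->
  (forall s, s \in `[0, t0] -> continuous (f s)) ->
  (forall s, s \in `[0, t0] -> vanishes_at_infinity (f s)) ->
  (forall s, s \in `[0, t0] -> forall e, 0 < e ->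
    \forall r \near s, r \in `[0, t0] -> forall x, `|f r x - f s x| <= e) ->
  exists B, forall s x, s \in `[0, t0] -> `|f s x| <= B.
Proof.
move=> t00 cf f0 ft.
have nmax s : exists x0, s \in `[0, t0] -> forall x, `|f s x| <= `|f s x0|.
  have [si|] := boolP (s \in `[0, t0]); last by exists 0.
  have [||//|x0 hx0] := @vanishing_max (fun x => `|f s x|) 0.
  - by move=> x; apply: cvg_norm; exact: cf.
  - move=> e e0; have [M M0 hM] := f0 s si e e0; exists M => // x /hM.
    by rewrite normr_id.
  by exists x0.
have [X hX] := choice nmax.
have cF : {within `[0, t0], continuous (fun s => `|f s (X s)|)}.
  apply: (@within_continuous_sup (fun s x => `|f s x|)) => // s si e e0.
  apply: filterS (ft s si e e0) => r h ri x.
  exact: le_trans (ler_dist_dist _ _) (h ri x).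
have [s1 _ hs1] := EVT_max t00 cF.
by exists `|f s1 (X s1)| => s x si; apply: le_trans (hX s si x) (hs1 s si).
Qed.

End finite_propagation.

(** * The Dullin-Gottwald-Holm equation *)

Section dullin_gottwald_holm.
Context {R : realType}.
Implicit Types (f : R -> R) (u v : R -> R -> R) (T : \bar R).

Lemma lifespan_interval_nbhs T (s : R) : 0 < s -> (s%:E < T)%E ->
  \forall r \near s, lifespan_interval T r.
Proof.
move=> s0 sT.
have [b sb bT] : exists2 b : R, s < b & (b%:E <= T)%E.
  case: T sT => [b| |//]; first by rewrite lte_fin => sb; exists b.
  by move=> _; exists (s + 1); rewrite ?ltrDl ?leey.
near=> r; split; first by apply: ltW; near: r; exact: lt_nbhsr.
apply: lt_le_trans bT; rewrite lte_fin; near: r; exact: lt_nbhsl.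
Unshelve. all: by end_near. Qed.

(** Convergence in H^(k+1) gives uniform convergence of derivatives up to order [k]; the norm is
    taken below [e / 2] because [sobolev_bound] loses a factor 2. *)
Lemma C0_sobolev_near T k u j s e : C0_sobolev T k.+1 u -> (j <= k)%N ->
  lifespan_interval T s -> 0 < e ->
  \forall r \near s, lifespan_interval T r ->
    forall x, `|derive1n j (u r) x - derive1n j (u s) x| <= e.
Proof.
move=> [ku cu] jk sT e0; have e20 : 0 < e / 2 by rewrite divr_gt0.
have : \forall r \near within (lifespan_interval T) (nbhs s),
    (sobolev_norm k.+1 (u r \- u s)%R <= (e / 2)%:E)%E.
  by apply: cvge0_near_le e20; exact: cu.
rewrite near_withinE; apply: filterS => r h rT x.
have E : u r \- u s = (fun x => 1 * u r x + - 1 * u s x).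
  by apply/funext => y; rewrite mul1r mulN1r.
have kE : sobolev k.+1 (u r \- u s).
  by rewrite E; apply: sobolev_lin; exact: ku.
have := sobolev_bound e20 jk kE (h rT) x.
by rewrite E (derive1n_lin _ _ jk (ku r rT) (ku s sT)) mul1r mulN1r mulrC divfK.
Qed.

Lemma C0_sobolev_bounded T k u j t : C0_sobolev T k.+1 u -> (j <= k)%N ->
  0 <= t -> (t%:E < T)%E ->
  exists B, forall s x, s \in `[0, t] -> `|derive1n j (u s) x| <= B.
Proof.
move=> ku jk t0 tT.
have sT s : s \in `[0, t] -> lifespan_interval T s.
  rewrite in_itv/= => /andP[s0 st]; split=> //.
  by rewrite (le_lt_trans _ tT)// lee_fin.
apply: uniformly_bounded => // s /[dup] si /sT sT'.
- by apply: sobolev_continuous jk _; case: ku => + _; apply.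
- by move=> e e0; apply: sobolev_decay jk _ e0; case: ku => + _; apply.
- move=> e e0; apply: filterS (C0_sobolev_near ku jk sT' e0) => r h ri x.
  exact: h (sT r ri) x.
Qed.

Lemma subr_interchange (a b c d : R) : a - b - (c - d) = a - c - (b - d).
Proof. by ring. Qed.

Lemma momentum_vanishes f : sobolev 4 f -> vanishes_at_infinity (momentum f).
Proof.
move=> kf e e0; have e20 : 0 < e / 2 by rewrite divr_gt0.
have [M M0 hM] := @sobolev_decay _ 0 3 _ _ isT kf e20.
have [M' M0' hM'] := @sobolev_decay _ 2 3 _ _ isT kf e20.
exists (M + M'); first by rewrite addr_gt0.
move=> x xM; rewrite /momentum [leRHS]splitr (le_trans (ler_normB _ _))// lerD//.
  by apply: hM; apply: le_trans xM; rewrite lerDl ltW.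
by apply: hM'; apply: le_trans xM; rewrite lerDr ltW.
Qed.

Lemma momentum_derivable f x : sobolev 4 f ->
  derivable (momentum f) x 1 /\
  derive1 (momentum f) x = derive1 f x - derive1n 3 f x.
Proof.
move=> kf.
have d0 : derivable f x 1 by exact: (@sobolev_derivable _ 0 3 f isT kf x).
have d2 : derivable (derive1n 2 f) x 1 by exact: (@sobolev_derivable _ 2 3 f isT kf x).
have e3 : derive1n 3 f x = 'D_1 (derive1n 2 f) x by exact: (derive1E (derive1n 2 f) x).
split; first exact: (derivableB d0 d2).
rewrite e3 (derive1E f x) derive1E; exact: (deriveB d0 d2).
Qed.

(** With [2 * omega = - gamma], the dispersive terms combine into
    [- gamma * (ux - uxxx) = - gamma * mx]. *)
Lemma DGH_transport (omega gamma mt ux uxxx mx m0 u0 : R) : omega + gamma / 2 = 0 ->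
  mx = ux - uxxx ->
  mt + 2 * omega * ux + u0 * mx + 2 * ux * m0 = - gamma * uxxx ->
  mt + (u0 - gamma) * mx + 2 * ux * m0 = 0.
Proof.
move=> /eqP; rewrite addr_eq0 => /eqP -> -> h.
have -> : mt = - gamma * uxxx - 2 * - (gamma / 2) * ux - u0 * (ux - uxxx) - 2 * ux * m0.
  by rewrite -h; ring.
by field.
Qed.

(** The difference quotients of [u] converge in H^3, hence uniformly together with their second
    space derivatives, so those of the momentum converge to the momentum of [v]. *)
Lemma momentum_time_derivable T u (s x : R) : C1_sobolev T 3 u -> 0 < s ->
  (s%:E < T)%E -> derivable (fun r => momentum (u r) x) s 1.
Proof.
move=> [[ku _] [v [[kv _] duv]]] s0 sT.
have sL : lifespan_interval T s by split=> //; exact: ltW.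
apply/cvg_ex; exists (momentum (v s) x).
apply/cvgrPdist_le => e e0.
(* Two applications of [sobolev_bound], for orders 0 and 2, each cost twice the norm. *)
have e4E : 2 * (e / 4) + 2 * (e / 4) = e by field.
have e40 : 0 < e / 4 by rewrite divr_gt0.
have : \forall r \near within (lifespan_interval T `\ s) (nbhs s),
    (sobolev_norm 3 (fun x => (r - s)^-1 * (u r x - u s x) - v s x)%R <= (e / 4)%:E)%E.
  by apply: cvge0_near_le e40; exact: duv.
rewrite near_withinE => h1.
have h2 := lifespan_interval_nbhs s0 sT.
pose P (r : R) := r != s ->
    `|momentum (v s) x - (r - s)^-1 * (momentum (u r) x - momentum (u s) x)| <= e.
have h3 : \forall r \near s, P r.
  apply: filterS2 h1 h2 => r h1 rT rs.
  have /h1 {}h1 : (lifespan_interval T `\ s) r by split=> //; exact/eqP.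
  pose q := fun x => 1 * ((r - s)^-1 * u r x + - (r - s)^-1 * u s x) + - 1 * v s x.
  have qE : (fun x => (r - s)^-1 * (u r x - u s x) - v s x) = q.
    by apply/funext => y; rewrite /q; ring.
  rewrite qE in h1.
  have kuu : sobolev 3 (fun x => (r - s)^-1 * u r x + - (r - s)^-1 * u s x).
    by apply: sobolev_lin; exact: ku.
  have kq : sobolev 3 q by apply: sobolev_lin => //; exact: kv.
  have q0 := @sobolev_bound _ 0 2 _ _ e40 isT kq h1 x.
  have q2 := @sobolev_bound _ 2 2 _ _ e40 isT kq h1 x.
  have E : momentum (v s) x - (r - s)^-1 * (momentum (u r) x - momentum (u s) x) =
      derive1n 2 q x - q x.
    rewrite /q (@derive1n_lin _ 2 _ _ _ _ 2)//; last exact: kv.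
    rewrite (@derive1n_lin _ 2 _ _ _ _ 2)//; [|exact: ku..].
    rewrite /momentum; move: (_^-1) (u r x) (u s x) (v s x).
    move: (derive1n 2 (u r) x) (derive1n 2 (u s) x) (derive1n 2 (v s) x) => *.
    by ring.
  rewrite E (le_trans (ler_normB _ _))// (le_trans (lerD q2 q0))//.
  by rewrite e4E.
have hs : h + s @[h --> (0 : R)] --> s.
  by rewrite -[X in _ --> X]add0r; apply: cvgD; [exact: cvg_id|exact: cvg_cst].
have h4 : \forall h \near (0 : R)^', P (h + s).
  have h0 : \forall h \near (0 : R), P (h + s) by exact: hs h3.
  by rewrite near_withinE; apply: filterS h0 => h + _.
apply: filterS2 h4 (nbhs_dnbhs_neq (0 : R)) => h + hn0.
rewrite /P addrK /= /GRing.scale/= mulr1; apply.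
by rewrite -subr_eq0 addrK.
Qed.

End dullin_gottwald_holm.

Theorem theorem2p1 (R : realType) (omega gamma : R) (u0 : R -> R)
    (T : \bar R) (u : R -> R -> R) :
  sobolev 4 u0 ->
  DGH_solution_with_lifespan omega gamma u0 T u ->
  compactly_supported (fun x => momentum u0 x + omega + gamma / 2) ->
  forall t : R, 0 < t -> (t%:E < T)%E ->
    compactly_supported (fun x => momentum (u t) x + omega + gamma / 2).
Proof.
move=> ku0 [T0 [Cu C1u eqn uu0] _] /compactly_supported_bounded[M M0 hM] t t0 tT.
have [ku _] := Cu.
have c0 : omega + gamma / 2 = 0.
  apply/eqP; rewrite -normr_le0; apply/ler_addgt0Pl => e e0; rewrite addr0.
  have [M' M0' hM'] := momentum_vanishes ku0 e0.
  (* A point beyond both radii: there [momentum u0] equals [- (omega + gamma / 2)] and is at most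
     [e] in absolute value. *)
  pose x := M + M' + 1.
  have x0 : 0 < x by rewrite /x !addr_gt0.
  have := hM x; rewrite gtr0_norm// => /(_ _)/eqP; rewrite -addrA addr_eq0 => h.
  rewrite -normrN -(eqP (h _)); last by rewrite /x; lra.
  by apply: hM'; rewrite gtr0_norm// /x; lra.
have u00 : u 0 = u0 by exact/funext.
have sT s : s \in `[0, t] -> lifespan_interval T s.
  rewrite in_itv/= => /andP[s0 st]; split=> //.
  by rewrite (le_lt_trans _ tT)// lee_fin.
have [K hK] := C0_sobolev_bounded (j := 0) Cu isT (ltW t0) tT.
have [B hB] := C0_sobolev_bounded (j := 1) Cu isT (ltW t0) tT.
pose m s x := momentum (u s) x.
(* All bounds are taken on the closed interval [[0, t]] with [t < T]; [K] bounds [u], so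
   [K + |gamma|] bounds the velocity [u - gamma]. *)
have tm : transport m (fun s x => u s x - gamma) (fun s x => 2 * derive1 (u s) x)
    t (K + `|gamma|) (2 * B).
  split=> //.
  - move=> s si x; apply: cvgB.
      exact: (@sobolev_continuous _ 0 3 _ isT (ku s (sT s si))).
    exact: (@sobolev_continuous _ 2 3 _ isT (ku s (sT s si))).
  - by move=> s si; apply: momentum_vanishes; exact: ku (sT s si).
  - move=> s si e e0; have e20 : 0 < e / 2 by rewrite divr_gt0.
    have h0 := C0_sobolev_near (j := 0) Cu isT (sT s si) e20.
    have h2 := C0_sobolev_near (j := 2) Cu isT (sT s si) e20.
    apply: filterS2 h0 h2 => r h0 h2 /sT rT x.
    have -> : m r x - m s x = (u r x - u s x) - (derive1n 2 (u r) x - derive1n 2 (u s) x).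
      exact: subr_interchange.
    by rewrite [leRHS]splitr (le_trans (ler_normB _ _))// lerD ?h0 ?h2.
  - move=> s x /andP[s0 st].
    have si : s \in `[0, t] by rewrite in_itv/= ltW.
    have [_ sT'] := sT s si.
    have [dm dmE] := momentum_derivable x (ku s (sT s si)).
    split; [exact: dm|exact: momentum_time_derivable C1u s0 sT'|].
    exact: (DGH_transport c0 dmE (eqn s x s0 sT')).
  - move=> s x si; apply: le_trans (ler_normB _ _) _.
    by rewrite lerD2r; exact: hK.
  - by move=> s x si; rewrite normrM ger0_norm// ler_wpM2l//; exact: hB.
have supp x : M + (K + `|gamma|) * t < `|x| -> m t x = 0.
  have ti : t \in `[0, t] by rewrite in_itv/= ltW /=.
  move=> xM; apply: (transport_support tm _ ti xM).
  move=> y My; have := hM y My; rewrite -addrA c0 addr0 -u00.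
  by [].
apply: (@compactly_supported_itv _ _ (- (M + (K + `|gamma|) * t)) (M + (K + `|gamma|) * t)).
move=> x; rewrite in_itv/= -ler_norml -ltNge => /supp mx.
by rewrite -addrA c0 addr0.
Qed.
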